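(* Let $G$ be a connected, locally finite graph, and let $\Gamma$ be a transitive nonunimodular subgroup of $\mathrm{Aut}(G)$. Then the function $$\mathbb{R}\to(0,z_t],\qquad \lambda\mapsto z_{c,\lambda}$$ is continuous, and is strictly increasing on $(-\infty,1/2]$.
   Context: Let $G=(V,E)$ be a connected, locally finite graph with automorphism group $\mathrm{Aut}(G)$. A subgroup $\Gamma\subseteq \mathrm{Aut}(G)$ is transitive if for any $u,v\in V$ there is $\gamma\in\Gamma$ with $\gamma u=v$. The modular function $\Delta=\Delta_\Gamma:V^2\to(0,\infty)$ of a transitive subgroup $\Gamma$ is $\Delta(x,y)=|\mathrm{Stab}_y x|/|\mathrm{Stab}_x y|$, where $\mathrm{Stab}_x y$ is the orbit of $y$ under the stabilizer of $x$ in $\Gamma$. $\Gamma$ is unimodular if $\Delta\equiv 1$, and nonunimodular otherwise. A self-avoiding walk (SAW) is a path in $G$ visiting each vertex at most once. Fix a root vertex $0\in V$. For $\lambda\in\mathbb{R}$ and $n\ge0$ let $Z(\lambda;n)=\sum_{\omega}\Delta^\lambda(0,\omega^+)$, the sum over all SAWs $\omega$ of length $n$ starting at $0$, where $\omega^+$ is the endpoint of $\omega$. Then $Z(\lambda;n+m)\le Z(\lambda;n)Z(\lambda;m)$, so $\mu_{c,\lambda}=\lim_{n\to\infty}Z(\lambda;n)^{1/n}=\inf_{n\ge1}Z(\lambda;n)^{1/n}$ is well defined; set $z_{c,\lambda}=\mu_{c,\lambda}^{-1}$ and $z_t=z_{c,1/2}$. *)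

(* Defs.v *)
From HB Require Import structures.
From mathcomp Require Import all_boot all_order all_algebra.
From mathcomp Require Import finmap.
From mathcomp Require Import all_classical all_reals all_analysis.

Set Implicit Arguments.
Unset Strict Implicit.
Unset Printing Implicit Defensive.
Import Order.TTheory GRing.Theory Num.Theory.
Import numFieldNormedType.Exports.
Local Open Scope classical_set_scope.
Local Open Scope ring_scope.

Section Graphs.
Variable V : choiceType.
Implicit Types (e : rel V) (Gamma : set (V -> V)).

Definition simple_graph e : Prop := symmetric e /\ irreflexive e.

Definition connected_graph e : Prop :=
  forall x y : V, exists2 p : seq V, path e x p & last x p = y.

Definition locally_finite_graph e : Prop :=
  forall x : V, finite_set [set y | e x y].

Definition graph_aut e : set (V -> V) :=
  [set g | bijective g /\ forall x y, e (g x) (g y) = e x y].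

Definition aut_subgroup e Gamma : Prop :=
  [/\ Gamma `<=` graph_aut e,
      Gamma id,
      forall g h, Gamma g -> Gamma h -> Gamma (g \o h) &
      forall g h, Gamma g -> cancel g h -> cancel h g -> Gamma h].

Definition transitive_group Gamma : Prop :=
  forall u v : V, exists2 g, Gamma g & g u = v.

Definition stabilizer Gamma (x : V) : set (V -> V) :=
  [set g | Gamma g /\ g x = x].

Definition stab_orbit Gamma (x y : V) : set V :=
  [set g y | g in stabilizer Gamma x].

(* [fset_set] is empty on infinite sets; the stabilizer orbits are finite in a
   connected, locally finite graph. *)
Definition modular_function (R : realType) Gamma (x y : V) : R :=
  #|` fset_set (stab_orbit Gamma y x)|%:R
  / #|` fset_set (stab_orbit Gamma x y)|%:R.

Definition unimodular (R : realType) Gamma : Prop :=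
  forall x y : V, modular_function R Gamma x y = 1.

(* A walk of length n started at o is encoded by the n vertices that follow o;
   its endpoint is then [last o p]. *)
Definition saw e (o : V) (n : nat) : set (seq V) :=
  [set p | [/\ size p = n, path e o p & uniq (o :: p)]].

Definition saw_Z (R : realType) e Gamma (o : V) (lambda : R) (n : nat) : R :=
  \sum_(p \in saw e o n) modular_function R Gamma o (last o p) `^ lambda.

Definition mu_c (R : realType) e Gamma (o : V) (lambda : R) : R :=
  limn (fun n => saw_Z e Gamma o lambda n `^ (n%:R^-1)).

Definition z_c (R : realType) e Gamma (o : V) (lambda : R) : R :=
  (mu_c e Gamma o lambda)^-1.

Definition z_t (R : realType) e Gamma (o : V) : R :=
  z_c e Gamma o (2^-1 : R).

End Graphs.

(* Main.v *)
Require Import Defs.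
From HB Require Import structures.
From mathcomp Require Import all_boot all_order all_algebra.
From mathcomp Require Import finmap.
From mathcomp Require Import all_classical all_reals all_analysis.
From mathcomp Require Import lra.

Set Implicit Arguments.
Unset Strict Implicit.
Unset Printing Implicit Defensive.
Import Order.TTheory GRing.Theory Num.Theory.
Import numFieldNormedType.Exports.
Local Open Scope classical_set_scope.
Local Open Scope ring_scope.

(** Let [height x y] be the logarithm of the modular function. It is an
    additive cocycle, invariant under the group ([modular_cocycle],
    [modular_translate]), so that the weight [z ^ n * exp (k * height)] of a
    walk of length [n] is multiplicative under concatenation, and the sum of the
    weights over an invariant family of walks does not depend on the starting
    vertex. The partition function [Z k n] is therefore submultiplicative in
    [n], its growth rate [mu k] exists, and [mu k ^ n <= Z k n]. As the group is
    not unimodular, every vertex has a neighbour at a fixed positive height;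
    climbing steps produce arbitrarily long self-avoiding walks, and [mu k > 0].

    A walk of length [n] has height at most [M n], so [ln (mu k)] is Lipschitz
    in [k]: this is continuity. The tilted mass-transport principle
    ([tilted_mass_transport]), applied to the reversal of walks, turns the tilt
    [k] into [1 - k]; hence [Z (1 - k) n = Z k n], and for [a <= k <= 1 - a] the
    termwise bound [exp (k h) <= exp (a h) + exp ((1 - a) h)] gives
    [mu k <= mu a]. In particular [mu] is minimal at 1/2.

    For strictness let [a < k <= 1/2] and suppose that [mu a <= mu k]. Take
    [z < 1 / mu k], so that the generating functions of self-avoiding walks with
    tilts [a], [1 - a], [k] and [1 - k] are all finite at [z]. A bridge is a
    walk whose start is its strict lowest point and whose endpoint is a highest
    point (or the same upside down). Every bridge begins with a unique
    irreducible bridge; if [I] and [B] are the generating functions of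
    irreducible bridges and of bridges, then [I * B <= B] and [B <= I * (1 + B)].
    The first inequality gives [I <= 1] at the tilts [a] and [1 - a]. At a tilt
    strictly in between, [I] is smaller by at least the difference of the
    weights of a single climbing (or descending) step, which is bounded below
    when [z] stays away from 0. The second inequality then bounds [B] uniformly
    in [z] ([bridge_sum_bound]).

    It remains to pass from bridges to all walks, following Hammersley and
    Welsh. A half-space walk stays strictly above its start; cut at its last
    highest vertex, it is a bridge followed by a half-space walk in the opposite
    direction and of smaller span. Iterating, the spans decrease strictly, and
    the generating function of half-space walks is at most the product of
    [1 + B_t] over all spans [t], hence at most the exponential of the sum of
    all bridges ([halfspace_sum_bound]). Cutting a self-avoiding walk at its last
    lowest vertex gives two half-space walks, one of them reversed
    ([all_saw_sum_bound]). So the generating function with tilt [k] stays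
    bounded as [z] increases to [1 / mu k], although it dominates the sum of
    [(z * mu k) ^ n]: a contradiction. *)

(** * Sums of nonnegative terms *)

Section NonnegativeSums.
Local Open Scope ereal_scope.
Variable R : realType.

Lemma esum_le_bound (T : choiceType) (A : set T) (a : T -> \bar R) (c : \bar R) :
  (forall X, finite_set X -> X `<=` A -> \sum_(x \in X) a x <= c) ->
  \esum_(x in A) a x <= c.
Proof. by move=> h; apply: ge_ereal_sup => _ [X [finX XA] <-]; exact: h. Qed.

Lemma esum_subset (T : choiceType) (A B : set T) (a : T -> \bar R) :
  A `<=` B -> \esum_(x in A) a x <= \esum_(x in B) a x.
Proof.
move=> AB; apply: esum_le_bound => X finX XA; apply: esum_ge.
by exists X => //; split => //; apply: subset_trans AB.
Qed.

Lemma esum_term (T : choiceType) (A : set T) (a : T -> \bar R) (x : T) :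
  A x -> 0 <= a x -> a x <= \esum_(x in A) a x.
Proof.
move=> Ax ax0; rewrite -(esum_set1 ax0); apply: esum_subset => _ /= -> //.
Qed.

Lemma esumZ (T : choiceType) (A : set T) (a : T -> \bar R) (c : R) :
  (0 <= c)%R -> (forall x, 0 <= a x) ->
  \esum_(x in A) (c%:E * a x) = c%:E * \esum_(x in A) a x.
Proof.
have main d : (0 <= d)%R -> forall b : T -> \bar R, (forall x, 0 <= b x) ->
    \esum_(x in A) (d%:E * b x) <= d%:E * \esum_(x in A) b x.
  move=> d0 b b0; apply: esum_le_bound => X finX XA.
  rewrite -ge0_mule_fsumr// lee_wpmul2l ?lee_fin//.
  by apply: esum_ge; exists X.
rewrite le_eqVlt => /predU1P[<-|c0] a0.
  by rewrite mul0e esum1// => x _; rewrite mul0e.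
apply/eqP; rewrite eq_le main ?(ltW c0)//=.
have cN0 : c != 0%R by rewrite gt_eqF.
rewrite -[leRHS]mul1e -(mulfV cN0) EFinM -muleA lee_wpmul2l ?lee_fin ?(ltW c0)//.
rewrite -(@eq_esum _ _ A (fun x => (c^-1)%:E * (c%:E * a x))).
  by apply: main => [|x]; rewrite ?invr_ge0 ?mule_ge0 ?lee_fin// ?ltW.
by move=> x _; rewrite muleA -EFinM mulVf// mul1e.
Qed.

Lemma esum_le_surj (T T' : choiceType) (A : set T) (K : set T')
    (f : T' -> T) (a : T -> \bar R) :
  A `<=` f @` K -> (forall x, 0 <= a x) ->
  \esum_(x in A) a x <= \esum_(k in K) a (f k).
Proof.
move=> AK a0.
have [[k0 _]|noT'] := pselect (exists k : T', True); last first.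
  rewrite (_ : A = set0) ?esum_set0 ?esum_ge0//.
  by apply/seteqP; split => // x /AK[k]; case: noT'; exists k.
have /choice[s sP] : forall x, exists k, A x -> K k /\ f k = x.
  move=> x; have [/AK[k Kk fk]|nAx] := pselect (A x); last by exists k0.
  by exists k.
have sinj : set_inj A s.
  move=> x y /[!inE] /sP[_ fx] /sP[_ fy] sxy.
  by rewrite -fx -fy sxy.
rewrite (@eq_esum _ _ A a (fun x => a (f (s x)))); last first.
  by move=> x /sP[_ ->].
rewrite -(esum_image A s (fun k => a (f k)))//.
by apply: esum_subset => _ [x /sP[? _] <-].
Qed.

Lemma esum_ge_inj (T T' : choiceType) (A : set T) (K : set T')
    (f : T' -> T) (a : T -> \bar R) :
  set_inj K f -> f @` K `<=` A ->
  \esum_(k in K) a (f k) <= \esum_(x in A) a x.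
Proof. by move=> finj fKA; rewrite -esum_image//; exact: esum_subset. Qed.

Lemma esum_swap (T T' : choiceType) (P : T -> T' -> Prop)
    (a : T -> T' -> \bar R) :
  (forall x y, 0 <= a x y) ->
  \esum_(x in [set: T]) \esum_(y in [set y | P x y]) a x y =
  \esum_(y in [set: T']) \esum_(x in [set x | P x y]) a x y.
Proof.
move=> a0; rewrite !esum_esum//.
apply: (reindex_esum _ _ (fun k : T' * T => (k.2, k.1)))=> //=.
split.
- by move=> [y x] /= [].
- by move=> [y x] [y' x'] _ _ /= [-> ->].
- by move=> [x y] [_ /= Pxy]; exists (y, x).
Qed.

Lemma esum_cst (T : choiceType) (A : set T) (c : \bar R) :
  finite_set A -> 0 <= c ->
  \esum_(x in A) c = (#|` fset_set A|%:R)%:E * c.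
Proof.
move=> finA c0; rewrite esum_fset// fsbig_finite//=.
rewrite -[in LHS](mul1e c) -ge0_sume_distrl//.
by rewrite sumEFin big_const_seq iter_addr_0 count_predT.
Qed.

End NonnegativeSums.

(** * Finite orbits *)

Section CardSet.
Variable R : realType.

Lemma card_fset_set_image (T T' : choiceType) (f : T -> T') (A : set T) :
  finite_set A -> set_inj A f -> #|` fset_set (f @` A)| = #|` fset_set A|.
Proof.
move=> finA finj; rewrite fset_set_image// card_in_imfset// => x y.
by rewrite !in_fset_set//; exact: finj.
Qed.

Lemma card_fset_set_gt0 (T : choiceType) (A : set T) x :
  finite_set A -> A x -> (0 < #|` fset_set A|)%N.
Proof.
move=> finA Ax; rewrite cardfs_gt0; apply/fset0Pn; exists x.
by rewrite in_fset_set// inE.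
Qed.

Lemma card_fset_set_pairs (T T' : choiceType) (I : set T) (J : T -> set T')
    (c : nat) :
  finite_set I -> (forall x, I x -> finite_set (J x)) ->
  (forall x, I x -> #|` fset_set (J x)| = c) ->
  finite_set (I `*`` J) ->
  #|` fset_set (I `*`` J)| = (#|` fset_set I| * c)%N.
Proof.
move=> finI finJ cJ finIJ.
apply/eqP; rewrite -(eqr_nat R) natrM -eqe EFinM; apply/eqP.
rewrite -[LHS]mule1 -esum_cst//.
rewrite -(@esum_esum R _ _ I J (fun _ _ => 1%E))// -esum_cst ?lee_fin//.
by apply: eq_esum => x Ix; rewrite esum_cst ?mule1 ?cJ//; exact: finJ.
Qed.

End CardSet.

(** * Submultiplicative sequences *)

Section Submultiplicative.
Variable R : realType.

Lemma le_rootE (n : nat) (a b : R) : (0 < n)%N -> 0 <= a -> 0 <= b ->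
  (b <= a `^ n%:R^-1) = (b ^+ n <= a).
Proof.
move=> n0 a0 b0; rewrite -(ler_pXn2r n0) ?nnegrE ?powR_ge0//.
rewrite -[(a `^ _) ^+ n]powR_mulrn ?powR_ge0// -powRrM mulVf ?powRr1//.
by rewrite pnatr_eq0 -lt0n.
Qed.

Lemma root_ltE (n : nat) (a b : R) : (0 < n)%N -> 0 <= a -> 0 <= b ->
  (a `^ n%:R^-1 < b) = (a < b ^+ n).
Proof. by move=> n0 a0 b0; rewrite !ltNge le_rootE. Qed.

(** If [a > b] then [(a / b) ^+ n] would grow at least linearly. *)
Lemma exp_growth_le (a b K : R) : 0 < a -> 0 < b ->
  (forall n, a ^+ n <= K * b ^+ n) -> a <= b.
Proof.
move=> a0 b0 h; rewrite leNgt; apply/negP => ba.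
have c0 : 0 < ln (a / b) by rewrite ln_gt0// ltr_pdivlMr ?mul1r.
have := archi_boundP (ltW (divr_gt0 (ltr_pwDl ltr01 (normr_ge0 K)) c0)).
set n := Num.bound _ => nP.
have := h n; rewrite -ler_pdivrMr ?exprn_gt0// -expr_div_n.
rewrite -[a / b]lnK ?posrE ?divr_gt0// -expRM_natl; apply/negP; rewrite -ltNge.
apply: lt_le_trans (expR_ge1Dx _).
move: nP; rewrite ltr_pdivrMr// => nP.
by have := ler_norm K; lra.
Qed.

Variable a : nat -> R.
Hypotheses (a_gt0 : forall n, 0 < a n)
  (a_submul : forall n m, a (n + m)%N <= a n * a m).

Let E := [set a n `^ n%:R^-1 | n in [set n | (0 < n)%N]].

Lemma submul_inf_le n : inf E ^+ n <= a n.
Proof.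
have E0 : lbound E 0 by move=> _ [m _ <-]; exact: powR_ge0.
have [->|n0] := posnP n.
  by rewrite expr0; have := a_submul 0 0; rewrite addn0 ler_pMr.
have i0 : 0 <= inf E by apply: lb_le_inf => //; exists (a 1 `^ 1%:R^-1); exists 1%N.
rewrite -le_rootE ?(ltW (a_gt0 _))//.
by apply: ge_inf; [exists 0|exists n].
Qed.

Lemma submul_inf_ge0 : 0 <= inf E.
Proof.
apply: lb_le_inf; first by exists (a 1 `^ 1%:R^-1); exists 1%N.
by move=> _ [m _ <-]; exact: powR_ge0.
Qed.

(** Writing [n = q m + r] with [r < m], where [m] is chosen with
    [a m < nu ^+ m], gives [a n <= a m ^+ q * a r]. *)
Lemma submul_exp_bound nu : inf E < nu ->
  exists2 K, 0 < K & forall n, a n <= K * nu ^+ n.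
Proof.
move=> Enu; have nu0 : 0 < nu by apply: le_lt_trans Enu; exact: submul_inf_ge0.
have [] := inf_lt _ Enu; first by exists (a 1 `^ 1%:R^-1); exists 1%N.
move=> _ [m /= m0 <-]; rewrite root_ltE ?(ltW (a_gt0 _)) ?(ltW nu0)// => am.
have t0 r : 0 < a r / nu ^+ r by rewrite divr_gt0 ?exprn_gt0.
pose K := \sum_(r < m) a r / nu ^+ r.
have aK r : (r < m)%N -> a r <= K * nu ^+ r.
  move=> rm; rewrite -ler_pdivrMr ?exprn_gt0// /K (bigD1 (Ordinal rm))//= lerDl.
  by apply: sumr_ge0 => i _; exact/ltW.
have main q r : (r < m)%N -> a (q * m + r)%N <= K * nu ^+ (q * m + r).
  move=> rm; elim: q => [|q IH]; first exact: aK.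
  rewrite mulSn -addnA exprD mulrCA; apply: (le_trans (a_submul _ _)).
  by apply: ler_pM => //; exact/ltW.
exists K => [|n]; last by rewrite (divn_eq n m); apply: main; rewrite ltn_mod.
case: m m0 {am aK main} @K => // m _ K.
by rewrite /K big_ord_recl ltr_pwDl// sumr_ge0// => i _; exact/ltW.
Qed.

Lemma submul_cvg : 0 < inf E ->
  (fun n => a n `^ n%:R^-1) @ \oo --> inf E.
Proof.
move=> i0; apply/cvgrPdist_le => eps eps0.
pose nu := inf E + eps / 2.
have Enu : inf E < nu by rewrite /nu; lra.
have [K K0 aK] := submul_exp_bound Enu.
have nu0 : 0 < nu by rewrite /nu; lra.
have d0 : 0 < ln (inf E + eps) - ln nu.
  rewrite subr_gt0 ltr_ln ?posrE//; rewrite /nu; lra.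
near=> n.
have n0 : (0 < n)%N by near: n; exact: nbhs_infty_gt.
have low : inf E <= a n `^ n%:R^-1.
  by rewrite le_rootE ?(ltW i0) ?(ltW (a_gt0 n))// submul_inf_le.
rewrite distrC ger0_norm ?subr_ge0// lerBlDl.
have e0 : 0 < inf E + eps by lra.
apply: ltW; rewrite root_ltE ?(ltW (a_gt0 n)) ?(ltW e0)//.
apply: (le_lt_trans (aK n)).
rewrite -ltr_ln ?posrE ?mulr_gt0 ?exprn_gt0// lnM ?posrE ?exprn_gt0// !lnXn//.
rewrite -ltrBrDr -mulrnBl -mulr_natl -ltr_pdivrMr//.
by near: n; exact: nbhs_infty_gtr.
Unshelve. all: by end_near. Qed.

End Submultiplicative.

(** * A telescoping estimate and the last maximum of a list *)

Section HammersleyWelshLemmas.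
Variable R : realType.

(** Group the terms by key. If the terms with key [s] have total weight [W],
    then [W * exp (A s) <= exp (A s + W) - exp (A s)], and [A s + W] is at most
    the value of [A] at the next key: the sum telescopes. It replaces the
    product of [1 + W] over all keys. *)
Lemma sum_exp_potential (T : eqType) (P : T -> Prop) (key w : T -> R) (A : R -> R) :
  (forall q, 0 <= w q) -> (forall t, 0 <= A t) ->
  (forall s t X, s < t -> uniq X -> (forall q, q \in X -> P q /\ key q = s) ->
    A s + \sum_(q <- X) w q <= A t) ->
  forall X t, uniq X -> (forall q, q \in X -> P q /\ key q < t) ->
  \sum_(q <- X) w q * expR (A (key q)) <= expR (A t) - 1.
Proof.
move=> w0 A0 HA X; have [n] := ubnP (size X).
elim: n X => // n IH X; rewrite ltnS => Xn t uX XP.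
have [->|] := eqVneq X [::].
  by rewrite big_nil subr_ge0; have := expR_ge1Dx (A t); have := A0 t; lra.
move=> X0.
have [m mX mmax] : exists2 m, m \in X & forall q, q \in X -> key q <= key m.
  elim: X X0 {Xn uX XP} => // a [|b X] IHX _.
    by exists a => [|q]; rewrite ?mem_head// inE => /eqP ->.
  have [//|m mX mmax] := IHX.
  have [am|ma] := leP (key a) (key m).
    by exists m => [|q]; rewrite inE ?mX ?orbT// => /predU1P[->|/mmax].
  exists a => [|q]; rewrite ?mem_head// inE => /predU1P[->//|/mmax qm].
  by apply: le_trans qm _; exact: ltW.
set s := key m in mmax.
have st : s < t by exact: (XP m mX).2.
rewrite (bigID (fun q => key q == s))/= -big_filter -[X in _ + X]big_filter.
set X1 := [seq q <- X | key q == s]; set X2 := [seq q <- X | key q != s].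
have sum1 : \sum_(q <- X1) w q * expR (A (key q)) = (\sum_(q <- X1) w q) * expR (A s).
  rewrite mulr_suml !big_seq; apply: eq_bigr => q.
  by rewrite mem_filter => /andP[/eqP ->].
have sum2 : \sum_(q <- X2) w q * expR (A (key q)) <= expR (A s) - 1.
  apply: IH; last 2 first.
  - exact: filter_uniq.
  - move=> q; rewrite mem_filter => /andP[qs qX]; split; first exact: (XP q qX).1.
    by rewrite lt_neqAle qs mmax.
  apply: leq_trans Xn; rewrite size_filter -(count_predC (fun q => key q == s) X).
  rewrite -[ltnLHS]add0n -addSn leq_add2r -has_count; apply/hasP.
  by exists m.
have HX1 : A s + \sum_(q <- X1) w q <= A t.
  apply: HA => //; first exact: filter_uniq.
  move=> q; rewrite mem_filter => /andP[/eqP qs qX]; split=> //.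
  exact: (XP q qX).1.
rewrite sum1; set W := \sum_(q <- X1) w q in HX1 *.
have := expR_ge1Dx W; rewrite -(ler_pM2l (expR_gt0 (A s))) -expRD => h1.
have : expR (A s + W) <= expR (A t) by rewrite ler_expR.
by lra.
Qed.

Lemma split_last_max (V : eqType) (f : V -> R) (x : V) (p : seq V) :
  exists q r, [/\ p = q ++ r, all (fun y => f y <= f (last x q)) (x :: q) &
    all (fun y => f y < f (last x q)) r].
Proof.
elim: p x => [|y p IH] x; first by exists [::], [::]; rewrite /= lexx.
have [q [r [-> qmax rmax]]] := IH y.
have [xl|lx] := leP (f x) (f (last y q)).
  by exists (y :: q), r; split=> //=; rewrite xl.
exists [::], (y :: q ++ r); split; rewrite //= ?lexx//.
move: qmax => /= /andP[yl qmax]; rewrite (le_lt_trans yl lx) all_cat /=.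
move: qmax rmax => /allP qmax /allP rmax.
apply/andP; split; apply/allP => u ul.
  by apply: le_lt_trans lx; exact: qmax.
by apply: lt_trans lx; exact: rmax.
Qed.

End HammersleyWelshLemmas.

(** * The modular cocycle and the tilted mass-transport principle *)

Section SelfAvoidingWalks.
Variables (R : realType) (V : choiceType) (e : rel V) (Gamma : set (V -> V)).
Hypotheses (e_simple : simple_graph e) (e_connected : connected_graph e)
  (e_locally_finite : locally_finite_graph e)
  (Gamma_aut : aut_subgroup e Gamma) (Gamma_transitive : transitive_group Gamma).

Local Notation orb := (stab_orbit Gamma).
Local Notation N x y := #|` fset_set (orb x y)|.
Local Notation D := (modular_function R Gamma).

Lemma Gamma_comp g h : Gamma g -> Gamma h -> Gamma (g \o h).
Proof. by case: Gamma_aut => _ _ + _; apply. Qed.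

Lemma Gamma_edge g x y : Gamma g -> e (g x) (g y) = e x y.
Proof. by case: Gamma_aut => + _ _ _ Gg => /(_ g Gg)[]. Qed.

Lemma Gamma_inverse g : Gamma g ->
  exists h, [/\ Gamma h, cancel g h & cancel h g].
Proof.
move=> Gg; case: Gamma_aut => /(_ g Gg)[[h gh hg] _] _ _ /(_ g h Gg gh hg) Gh.
by exists h.
Qed.

Lemma Gamma_inj g : Gamma g -> injective g.
Proof. by move=> /Gamma_inverse[h [_ /can_inj]]. Qed.

Lemma Gamma_path g x p : Gamma g -> path e (g x) (map g p) = path e x p.
Proof.
by move=> Gg; elim: p x => //= y p IH x; rewrite IH Gamma_edge.
Qed.

Lemma walks_finite n x : finite_set [set p | size p = n /\ path e x p].
Proof.
elim: n x => [|n IH] x.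
  by apply: sub_finite_set (finite_set1 [::]) => p [/size0nil].
apply: (@sub_finite_set _ _ (\bigcup_(y in [set y | e x y])
   (cons y @` [set p | size p = n /\ path e y p]))).
  by move=> [|y p] [//= [sp] /andP[exy pp]]; exists y => //; exists p.
by apply: bigcup_finite => // y _; exact: finite_image.
Qed.

Lemma stab_orbit_finite x y : finite_set (orb x y).
Proof.
have [p xp <-] := e_connected x y.
apply: sub_finite_set (finite_image (last x) (walks_finite (size p) x)).
move=> _ [g [Gg gx] <-]; exists (map g p); last by rewrite -[in LHS]gx last_map.
by split; rewrite ?size_map// -[X in path _ X _]gx Gamma_path.
Qed.

Lemma stab_orbit_refl x y : orb x y y.
Proof. by exists id => //; split => //; case: Gamma_aut. Qed.

Lemma card_stab_orbit_gt0 x y : (0 < N x y)%N.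
Proof. exact: card_fset_set_gt0 (stab_orbit_finite x y) (stab_orbit_refl x y). Qed.

Lemma stab_orbit_translate g x y : Gamma g -> orb (g x) (g y) = g @` orb x y.
Proof.
move=> Gg; have [h [Gh gh hg]] := Gamma_inverse Gg.
apply/seteqP; split=> [_ [k [Gk kgx] <-]|_ [_ [k [Gk kx] <-] <-]].
  exists (h (k (g y))); last exact: hg.
  exists (h \o (k \o g)) => //; split; last by rewrite /= kgx gh.
  by do 2!apply: Gamma_comp => //.
exists (g \o (k \o h)); last by rewrite /= gh.
by split; [do 2!apply: Gamma_comp => //|rewrite /= gh kx].
Qed.

Lemma card_stab_orbit_translate g x y : Gamma g -> N (g x) (g y) = N x y.
Proof.
move=> Gg; rewrite stab_orbit_translate// card_fset_set_image//.
  exact: stab_orbit_finite.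
by move=> ? ? _ _; exact: Gamma_inj.
Qed.

Lemma modular_translate g x y : Gamma g -> D (g x) (g y) = D x y.
Proof. by move=> Gg; rewrite /modular_function !card_stab_orbit_translate. Qed.

Lemma modular_gt0 x y : 0 < D x y.
Proof. by rewrite divr_gt0// ltr0n card_stab_orbit_gt0. Qed.

Definition stab2_orbit x y z : set V :=
  [set g z | g in stabilizer Gamma x `&` stabilizer Gamma y].

Lemma stab2_orbitC x y z : stab2_orbit x y z = stab2_orbit y x z.
Proof. by rewrite /stab2_orbit setIC. Qed.

Definition pair_orbit x y z : set (V * V) :=
  [set (g y, g z) | g in stabilizer Gamma x].

(** Orbit-stabilizer for the action on pairs, by fibering over the first
    coordinate. *)
Lemma card_pair_orbit x y z :
  #|` fset_set (pair_orbit x y z)| =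
  (N x y * #|` fset_set (stab2_orbit x y z)|)%N.
Proof.
have finT : finite_set (stab2_orbit x y z).
  apply: sub_finite_set (stab_orbit_finite x z) => _ [g [? _] <-].
  by exists g.
pose J y' := [set z' | pair_orbit x y z (y', z')].
have JE g : stabilizer Gamma x g -> J (g y) = g @` stab2_orbit x y z.
  move=> [Gg gx]; have [h [Gh gh hg]] := Gamma_inverse Gg.
  apply/seteqP; split=> [_ [k [Gk kx] [kgy <-]]|_ [_ [k [[Gk kx] [_ ky]] <-] <-]].
    exists (h (k z)); last exact: hg.
    exists (h \o k) => //; split; split; rewrite /=; try exact: Gamma_comp.
      by rewrite kx -[in LHS]gx gh.
    by rewrite kgy gh.
  exists (g \o k); last by rewrite /= ky.
  by split; [exact: Gamma_comp|rewrite /= kx].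
have E : pair_orbit x y z = (orb x y) `*`` J.
  apply/seteqP; split=> [_ [g gS <-]|[y' z'] /= [_]].
    by split => /=; [exists g|exists g].
  by [].
have finJ y' : orb x y y' -> finite_set (J y').
  by move=> [g gS <-]; rewrite JE//; exact: finite_image.
rewrite E (card_fset_set_pairs R (c := #|` fset_set (stab2_orbit x y z)|))//.
- exact: stab_orbit_finite.
- move=> y' [g gS <-]; rewrite JE// card_fset_set_image// => ? ? _ _.
  by apply: Gamma_inj; case: gS.
- rewrite -E; apply: sub_finite_set
    (finite_setX (stab_orbit_finite x y) (stab_orbit_finite x z)).
  by move=> _ [g gS <-]; split => /=; exists g.
Qed.

(** Both sides count the orbit of the pair [(y, z)] under the stabilizer of
    [x]. *)
Lemma card_stab_orbit_exchange x y z :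
  (N x y * #|` fset_set (stab2_orbit x y z)| =
   N x z * #|` fset_set (stab2_orbit x z y)|)%N.
Proof.
rewrite -!card_pair_orbit.
rewrite -(@card_fset_set_image _ _ (fun k : V * V => (k.2, k.1)) (pair_orbit x z y)).
- congr (#|` fset_set _|); apply/seteqP; split=> [_ [g gS <-]|_ [_ [g gS <-] <-]].
    by exists (g z, g y) => //; exists g.
  by exists g.
- apply: sub_finite_set
    (finite_setX (stab_orbit_finite x z) (stab_orbit_finite x y)).
  by move=> _ [g gS <-]; split => /=; exists g.
- by move=> [? ?] [? ?] _ _ /= [-> ->].
Qed.

(** By [card_pair_orbit], [D x y] is the size of the orbit of [(x, z)] under the
    stabilizer of [y], divided by that of [(y, z)] under the stabilizer of [x].
    With [(x, y)] under the stabilizer of [z], only three numbers occur in the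
    three values of [D], and the quotients cancel. *)
Lemma modular_cocycle x y z : D x y * D y z = D x z.
Proof.
have T0 u v w : #|` fset_set (stab2_orbit u v w)|%:R != 0 :> R.
  rewrite pnatr_eq0 -lt0n; apply: (@card_fset_set_gt0 _ _ w).
    apply: sub_finite_set (stab_orbit_finite u w) => _ [g [? _] <-].
    by exists g.
  by exists id => //; case: Gamma_aut.
have N0 u v : (N u v)%:R != 0 :> R by rewrite pnatr_eq0 -lt0n card_stab_orbit_gt0.
have X u v w := congr1 (fun n => n%:R : R) (card_stab_orbit_exchange u v w).
have := X x y z; have := X y x z; have := X z x y; rewrite !natrM.
rewrite (stab2_orbitC y x) (stab2_orbitC z x) (stab2_orbitC z y) => h1 h2 h3.
rewrite /modular_function mulf_div; apply/eqP; rewrite eqr_div ?mulf_neq0//.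
apply/eqP.
set a := (N y x)%:R in h2 *; set b := (N z y)%:R in h1 *.
set c := (N x z)%:R in h3 *; set d := (N z x)%:R in h1 *.
set f := (N x y)%:R in h3 *; set k := (N y z)%:R in h2 *.
move: (T0 x y z) (T0 x z y) (T0 y z x).
set t1 : R := #|` fset_set (stab2_orbit x y z)|%:R in h2 h3 *.
set t2 : R := #|` fset_set (stab2_orbit x z y)|%:R in h1 h3 *.
set t3 : R := #|` fset_set (stab2_orbit y z x)|%:R in h1 h2 * => n1 n2 n3.
apply: (mulIf n1); apply: (mulIf n2); apply: (mulIf n3).
transitivity ((a * t1) * (b * t3) * (c * t2)); first by lra.
by rewrite h2 -h1 -h3; lra.
Qed.

(** Distribute the mass [f o x] evenly over the vertices [y] for which [(y, o)]
    lies in the orbit of [(o, x)]; invariance makes it equal to [f y o]. There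
    are [N o y] such [y] for a given [x], and [N y o] such [x] for a given [y],
    and the quotient of these two numbers is [D o y]. *)
Lemma tilted_mass_transport (o : V) (f : V -> V -> \bar R) :
  (forall x y, 0 <= f x y)%E ->
  (forall g x y, Gamma g -> f (g x) (g y) = f x y) ->
  (\esum_(x in [set: V]) f o x = \esum_(x in [set: V]) ((D o x)%:E * f x o))%E.
Proof.
move=> f0 finv.
pose P x y := exists g, [/\ Gamma g, g o = y & g x = o].
have Pl x y : P x y -> [set y' | P x y'] = orb o y.
  move=> [g [Gg go gx]]; have [h [Gh gh hg]] := Gamma_inverse Gg.
  apply/seteqP; split=> [y' [k [Gk ko kx]]|_ [k [Gk ko] <-]].
    exists (k \o h); last by rewrite /= -go gh ko.
    by split; [exact: Gamma_comp|rewrite /= -[in LHS]gx gh kx].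
  by exists (k \o g); split; [exact: Gamma_comp|rewrite /= go|rewrite /= gx].
have Pr x y : P x y -> [set x' | P x' y] = orb o x.
  move=> [g [Gg go gx]]; have [h [Gh gh hg]] := Gamma_inverse Gg.
  apply/seteqP; split=> [x' [k [Gk ko kx]]|_ [k [Gk ko] <-]].
    have [k' [Gk' kk' k'k]] := Gamma_inverse Gk.
    exists (k' \o g); last by rewrite /= gx -kx kk'.
    by split; [exact: Gamma_comp|rewrite /= go -ko kk'].
  have [k' [Gk' kk' k'k]] := Gamma_inverse Gk.
  exists (g \o k'); split; first exact: Gamma_comp.
    by rewrite /= -[in LHS]ko kk'.
  by rewrite /= kk'.
pose w y := (((N o y)%:R : R)^-1%:E * f y o)%E.
have w0 y : (0 <= w y)%E by rewrite mule_ge0// lee_fin invr_ge0.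
transitivity (\esum_(x in [set: V]) \esum_(y in [set y | P x y]) w y)%E.
  apply: eq_esum => x _; have [g Gg gx] := Gamma_transitive x o.
  have Px : P x (g o) by exists g.
  rewrite (Pl _ _ Px) (@eq_esum _ _ _ _ (fun=> (N o (g o))%:R^-1%:E * f o x))%E.
    rewrite esum_cst ?mule_ge0 ?lee_fin//; last exact: stab_orbit_finite.
    by rewrite muleA -EFinM mulfV ?mul1e// pnatr_eq0 -lt0n card_stab_orbit_gt0.
  move=> y Oy; have Py : P x y by move: Oy; rewrite -(Pl _ _ Px).
  rewrite /w (_ : N o y = N o (g o)); last by rewrite -(Pl _ _ Py) (Pl _ _ Px).
  have [h [Gh ho hx]] := Py; congr (_ * _)%E.
  by rewrite -(finv h o x Gh) ho hx.
rewrite esum_swap//; apply: eq_esum => y _.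
have [g Gg go] := Gamma_transitive o y; have [h [Gh gh hg]] := Gamma_inverse Gg.
have Py : P (h o) y by exists g.
rewrite (Pr _ _ Py) esum_cst//; last exact: stab_orbit_finite.
rewrite /w muleA -EFinM; congr ((_ * _)%:E * _)%E.
by rewrite -(card_stab_orbit_translate _ _ Gg) hg go.
Qed.

(** * Weighted sums over walks *)

Definition height x y : R := ln (modular_function R Gamma x y).

Lemma heightD x y z : height x y + height y z = height x z.
Proof.
rewrite /height -lnM ?posrE ?modular_gt0//.
by rewrite modular_cocycle.
Qed.

Lemma height_refl x : height x x = 0.
Proof. by have := heightD x x x; lra. Qed.

Lemma heightC x y : height y x = - height x y.
Proof. by have := heightD x y x; rewrite height_refl; lra. Qed.

Lemma height_translate g x y : Gamma g -> height (g x) (g y) = height x y.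
Proof. by move=> Gg; rewrite /height modular_translate. Qed.

Lemma modular_height x y : modular_function R Gamma x y = expR (height x y).
Proof. by rewrite lnK// posrE modular_gt0. Qed.

Definition walk_weight (z k : R) (x : V) (p : seq V) : R :=
  z ^+ size p * expR (k * height x (last x p)).

Definition walk_sum (z k : R) (x : V) (A : set (seq V)) : \bar R :=
  \esum_(p in A) (walk_weight z k x p)%:E.

Definition translation_invariant (A : V -> set (seq V)) : Prop :=
  forall g x p, Gamma g -> A x p -> A (g x) (map g p).

Section Weights.
Variables (z k : R).
Hypothesis z0 : 0 <= z.
Local Notation w := (walk_weight z k).
Local Notation S := (walk_sum z k).

Lemma walk_weight_ge0 x p : 0 <= w x p.
Proof. by rewrite mulr_ge0 ?exprn_ge0 ?expR_ge0. Qed.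

Lemma walk_sum_ge0 x A : (0 <= S x A)%E.
Proof. by apply: esum_ge0 => p _; rewrite lee_fin walk_weight_ge0. Qed.

Lemma walk_weight_nil x : w x [::] = 1.
Proof. by rewrite /walk_weight expr0 height_refl mulr0 expR0 mulr1. Qed.

Lemma walk_weight_cat x q r : w x (q ++ r) = w x q * w (last x q) r.
Proof.
rewrite /walk_weight size_cat exprD last_cat mulrACA -expRD -mulrDr.
by rewrite heightD.
Qed.

Lemma walk_weight_translate g x p : Gamma g -> w (g x) (map g p) = w x p.
Proof.
by move=> Gg; rewrite /walk_weight size_map last_map height_translate.
Qed.

Lemma walk_sum_invariant A x y : translation_invariant A -> S x (A x) = S y (A y).
Proof.
move=> Ainv.
have le u v : (S u (A u) <= S v (A v))%E.
  have [g Gg <-] := Gamma_transitive u v.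
  rewrite /walk_sum.
  rewrite (@eq_esum _ _ _ _ (fun p => (w (g u) (map g p))%:E)); last first.
    by move=> p _; rewrite walk_weight_translate.
  apply: (@esum_ge_inj R _ _ (A (g u)) (A u) (map g) (fun p => (w (g u) p)%:E)).
    by move=> p q _ _; exact: inj_map (Gamma_inj Gg) _ _.
  by move=> _ [p Ap <-]; exact: Ainv.
by apply: le_anti; apply/andP; split; exact: le.
Qed.

Lemma walk_sum_subset x A B : A `<=` B -> (S x A <= S x B)%E.
Proof. exact: esum_subset. Qed.

Lemma walk_sum_nil x : S x [set [::]] = 1%E.
Proof.
by rewrite /walk_sum esum_set1 ?walk_weight_nil// lee_fin walk_weight_ge0.
Qed.

Lemma walk_sumU x A B : (S x (A `|` B) <= S x A + S x B)%E.
Proof.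
rewrite /walk_sum (esumID A); last by move=> *; rewrite lee_fin walk_weight_ge0.
by apply: leeD; apply: esum_subset => p; [case|case=> -[]].
Qed.

(** The family [C q] of second pieces may depend on the first piece [q]; the
    decomposition of half-space walks needs this, as the span of each bridge
    limits the next one. *)
Lemma walk_sum_le_cat x A B (C : seq V -> set (seq V)) :
  (forall p, A p -> exists q r, [/\ p = q ++ r, B q & C q r]) ->
  (S x A <= \esum_(q in B) ((w x q)%:E * S (last x q) (C q)))%E.
Proof.
move=> AB; rewrite /walk_sum.
rewrite (@eq_esum _ _ B _
  (fun q => \esum_(r in C q) (w x q * w (last x q) r)%:E)); last first.
  move=> q _; rewrite -esumZ ?walk_weight_ge0//.
  by move=> r; rewrite lee_fin walk_weight_ge0.
rewrite (esum_esum (a := fun q r => (w x q * w (last x q) r)%:E)); last first.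
  by move=> q r _ _; rewrite lee_fin mulr_ge0 ?walk_weight_ge0.
rewrite [leRHS](@eq_esum _ _ _ _
  (fun qr : seq V * seq V => (w x (qr.1 ++ qr.2))%:E)); last first.
  by move=> qr _; rewrite walk_weight_cat.
apply: (@esum_le_surj R _ _ A (B `*`` C) (fun qr => qr.1 ++ qr.2)
  (fun p => (w x p)%:E)) => [p /AB[q [r [-> Bq Cr]]]|p].
  by exists (q, r).
by rewrite lee_fin walk_weight_ge0.
Qed.

Lemma walk_sum_le_cat_indep x A B C : translation_invariant C ->
  (forall p, A p -> exists q r, [/\ p = q ++ r, B q & C (last x q) r]) ->
  (S x A <= \esum_(q in B) ((w x q)%:E * S x (C x)))%E.
Proof.
move=> Cinv AB.
apply: (le_trans (walk_sum_le_cat x (C := fun q => C (last x q)) AB)).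
by apply: le_esum => q _; rewrite (walk_sum_invariant _ x Cinv).
Qed.

Lemma walk_sum_le_catM x A B C c : translation_invariant C ->
  (forall p, A p -> exists q r, [/\ p = q ++ r, B q & C (last x q) r]) ->
  (0 <= c) -> (S x (C x) <= c%:E)%E -> (S x A <= c%:E * S x B)%E.
Proof.
move=> Cinv AB c0 Cc; apply: (le_trans (walk_sum_le_cat_indep Cinv AB)).
rewrite /walk_sum -esumZ//; last by move=> *; rewrite lee_fin walk_weight_ge0.
apply: le_esum => q _; rewrite muleC lee_wpmul2r// lee_fin.
exact: walk_weight_ge0.
Qed.

(** The converse of [walk_sum_le_catM], when a concatenation determines its
    first piece. *)
Lemma walk_sum_ge_catM x A B C c : translation_invariant C ->
  (forall q r, B q -> C (last x q) r -> A (q ++ r)) ->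
  (forall q r q' r', B q -> C (last x q) r -> B q' -> C (last x q') r' ->
    q ++ r = q' ++ r' -> q = q') ->
  (0 <= c) -> (c%:E <= S x (C x))%E -> (c%:E * S x B <= S x A)%E.
Proof.
move=> Cinv BCA inj c0 Cc.
pose D q := C (last x q).
apply: (@le_trans _ _ (\esum_(qr in B `*`` D) (w x (qr.1 ++ qr.2))%:E)%E); last first.
  apply: (@esum_ge_inj R _ _ A _ _ (fun p => (w x p)%:E)).
    move=> [q r] [q' r'] /[!inE] -[/= Bq Cr] -[/= Bq' Cr'] E.
    by have qq' := inj _ _ _ _ Bq Cr Bq' Cr' E; move/eqP: E;
      rewrite qq' eqseq_cat// eqxx => /eqP ->.
  by move=> _ [[q r] [/= Bq Cr] <-]; exact: BCA.
under eq_esum do rewrite walk_weight_cat.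
rewrite -(esum_esum (a := fun q r => (w x q * w (last x q) r)%:E)); last first.
  by move=> q r _ _; rewrite lee_fin mulr_ge0 ?walk_weight_ge0.
rewrite /walk_sum -esumZ//; last by move=> *; rewrite lee_fin walk_weight_ge0.
apply: le_esum => q _.
rewrite [leRHS](@eq_esum _ _ _ _ (fun r => (w x q)%:E * (w (last x q) r)%:E))%E//.
rewrite esumZ ?walk_weight_ge0//; last by move=> *; rewrite lee_fin walk_weight_ge0.
rewrite [leLHS]muleC; apply: lee_wpmul2l; first by rewrite lee_fin walk_weight_ge0.
by move: Cc; rewrite (walk_sum_invariant x (last x q) Cinv) /walk_sum.
Qed.

End Weights.

(** * Reversal of walks *)

Lemma rev_walk (x : V) p : last x p :: rev (belast x p) = rev (x :: p).
Proof. by rewrite [x :: p]lastI rev_rcons. Qed.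

Lemma rev_walkK (x : V) p :
  last (last x p) (rev (belast x p)) = x /\
  rev (belast (last x p) (rev (belast x p))) = p.
Proof.
have := rev_walk (last x p) (rev (belast x p)).
by rewrite (rev_walk x p) revK => -[-> ->].
Qed.

Lemma size_rev_walk (x : V) p : size (rev (belast x p)) = size p.
Proof. by rewrite size_rev size_belast. Qed.

(** Transporting the weight of each walk from its start [x] to its endpoint [y]
    multiplies it by [D x y], and [D x y * D y x `^ k = D x y `^ (1 - k)]. *)
Lemma walk_sum_reverse z k x A : 0 <= z -> translation_invariant A ->
  walk_sum z k x (A x) =
  walk_sum z (1 - k) x [set p | A (last x p) (rev (belast x p))].
Proof.
move=> z0 Ainv.
pose B u v := [set p | A u p /\ last u p = v].
pose f u v := (\esum_(p in B u v) (walk_weight z k u p)%:E)%E.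
have w0 k' u p : (0 <= (walk_weight z k' u p)%:E)%E.
  by rewrite lee_fin walk_weight_ge0.
have f0 u v : (0 <= f u v)%E by apply: esum_ge0.
have fle g u v : Gamma g -> (f u v <= f (g u) (g v))%E.
  move=> Gg; rewrite /f.
  rewrite (@eq_esum _ _ _ _ (fun p => (walk_weight z k (g u) (map g p))%:E)).
    apply: (@esum_ge_inj R _ _ (B (g u) (g v)) _ (map g)
      (fun p => (walk_weight z k (g u) p)%:E)).
      by move=> p q _ _; exact: inj_map (Gamma_inj Gg) _ _.
    move=> _ [p [Ap pv] <-]; split; first exact: Ainv.
    by rewrite last_map pv.
  by move=> p _; rewrite walk_weight_translate.
have finv g u v : Gamma g -> f (g u) (g v) = f u v.
  move=> Gg; apply: le_anti; apply/andP; split; last exact: fle.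
  have [h [Gh gh hg]] := Gamma_inverse Gg.
  by have := fle h (g u) (g v) Gh; rewrite !gh.
transitivity (\esum_(y in [set: V]) f x y)%E.
  rewrite esum_esum//.
  rewrite (reindex_esum (A x) ([set: V] `*`` B x) (fun p => (last x p, p)))//.
  split=> [p Ap //|p q _ _ /= [_ ->] //|[y p] /= [_ [Ap py]]].
  by exists p => //; rewrite py.
rewrite (tilted_mass_transport x f0 finv).
transitivity (\esum_(y in [set: V]) \esum_(p in B y x)
    ((modular_function R Gamma x y)%:E * (walk_weight z k y p)%:E))%E.
  apply: eq_esum => y _; rewrite esumZ//.
  exact/ltW/modular_gt0.
rewrite esum_esum; last first.
  move=> y p _ _; rewrite mule_ge0// lee_fin.
  exact/ltW/modular_gt0.
rewrite (reindex_esum [set p | A (last x p) (rev (belast x p))]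
  ([set: V] `*`` fun y => B y x) (fun p => (last x p, rev (belast x p)))).
  apply: eq_esum => p /= _; rewrite modular_height -EFinM /walk_weight.
  rewrite size_rev_walk mulrCA -expRD (rev_walkK x p).1.
  by rewrite (heightC x (last x p)); congr (_ * expR _)%:E; lra.
split=> [p Ap|p q _ _ /= [pq1 pq2]|[y p] /= [_ [Ap py]]] /=.
- by split=> //; split=> //; rewrite (rev_walkK x p).1.
- by rewrite -(rev_walkK x p).2 pq1 pq2 (rev_walkK x q).2.
- exists (rev (belast y p)); rewrite -py (rev_walkK y p).1 (rev_walkK y p).2//.
Qed.

(** * The partition function of self-avoiding walks *)

Local Notation Z o k n := (@saw_Z V R e Gamma o k n).

Lemma saw_finite x n : finite_set (saw e x n).
Proof. by apply: sub_finite_set (walks_finite n x) => p [? ?]. Qed.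

Lemma saw_invariant n : translation_invariant (fun x => saw e x n).
Proof.
move=> g x p Gg [sp pp up]; split; first by rewrite size_map.
  by rewrite Gamma_path.
by rewrite -map_cons map_inj_uniq//; exact: Gamma_inj.
Qed.

Lemma walk_sum_saw z o k n : 0 <= z ->
  walk_sum z k o (saw e o n) = (z ^+ n * Z o k n)%:E.
Proof.
move=> z0; rewrite EFinM /saw_Z -fsumEFin; last exact: saw_finite.
rewrite -esum_fset; last 2 first.
- exact: saw_finite.
- by move=> p _; rewrite lee_fin powR_ge0.
rewrite -esumZ ?exprn_ge0//; last by move=> p; rewrite lee_fin powR_ge0.
apply: eq_esum => p [sp _ _].
by rewrite -EFinM /walk_weight sp modular_height /powR gt_eqF ?expR_gt0// expRK.
Qed.

Lemma saw_Z_walk_sum o k n : (Z o k n)%:E = walk_sum 1 k o (saw e o n).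
Proof. by rewrite walk_sum_saw// expr1n mul1r. Qed.

Lemma saw_Z_submul o k n m : Z o k (n + m) <= Z o k n * Z o k m.
Proof.
rewrite mulrC -lee_fin EFinM (saw_Z_walk_sum o k n) saw_Z_walk_sum.
apply: (walk_sum_le_catM ler01 (@saw_invariant m)).
- move=> p [sp pp up]; exists (take n p), (drop n p).
  have ple : (n <= size p)%N by rewrite sp leq_addr.
  move: pp up; rewrite -{1 2}(cat_take_drop n p) cat_path -cat_cons cat_uniq.
  move=> /andP[p1 p2] /and3P[u1 u2 u3].
  rewrite cat_take_drop; split=> //; split=> //.
  + by rewrite size_takel.
  + by rewrite size_drop sp addKn.
  + rewrite cons_uniq u3 andbT; apply: contra u2 => u2.
    by apply/hasP; exists (last o (take n p)) => //; exact: mem_last.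
- by rewrite -lee_fin saw_Z_walk_sum walk_sum_ge0.
- by rewrite saw_Z_walk_sum.
Qed.

Lemma saw_rev (x : V) n p :
  saw e x n p -> saw e (last x p) n (rev (belast x p)).
Proof.
move=> [sp pp up]; split; first by rewrite size_rev_walk.
  rewrite rev_path; case: e_simple => esym _.
  by rewrite (eq_path (e' := e))// => u v; exact: esym.
by rewrite rev_walk rev_uniq.
Qed.

(** The tilted mass-transport principle applied to the reversal of walks. *)
Lemma saw_Z_symmetric o k n : Z o (1 - k) n = Z o k n.
Proof.
apply: EFin_inj; rewrite !saw_Z_walk_sum [RHS](walk_sum_reverse _ _ _ (@saw_invariant n))//.
congr (walk_sum _ _ _ _); apply/seteqP; split=> p /=; first exact: saw_rev.
by move=> /saw_rev; rewrite (rev_walkK o p).1 (rev_walkK o p).2.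
Qed.

(** By transitivity all edge heights occur at one vertex, which has finitely
    many neighbours. *)
Lemma edge_height_bounded : exists2 M, 0 <= M &
  forall x y, e x y -> `|height x y| <= M.
Proof.
have [[v0 _]|noV] := pselect (exists o : V, True); last first.
  by exists 0 => // x; case: noV; exists x.
have finN := e_locally_finite v0.
exists (\sum_(y <- fset_set [set y | e v0 y]) `|height v0 y|); first exact: sumr_ge0.
move=> x y exy; have [g Gg gx] := Gamma_transitive x v0.
rewrite -(height_translate x y Gg) gx (big_fsetD1 (g y))/= ?lerDl ?sumr_ge0//.
by rewrite in_fset_set// inE /= -gx Gamma_edge.
Qed.

Lemma path_height_bounded M x p :
  (forall x y, e x y -> `|height x y| <= M) ->
  path e x p -> `|height x (last x p)| <= M * (size p)%:R.
Proof.
move=> MP; elim: p x => [|y p IH] x /=; first by rewrite height_refl normr0 mulr0.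
move=> /andP[exy pp]; rewrite -(heightD x y) -natr1 mulrDr mulr1 addrC.
by apply: le_trans (ler_normD _ _) _; apply: lerD; [exact: IH|exact: MP].
Qed.

Section Nonunimodular.
Hypothesis Gamma_nonunimodular : ~ unimodular R Gamma.

(** If all edges were level, so would be all paths, and the modular function
    would be constantly 1. *)
Lemma climbing_edge : exists2 eta, 0 < eta &
  forall x, (exists2 y, e x y & height x y = eta) /\
            (exists2 y, e x y & height x y = - eta).
Proof.
have [u [v [euv hv]]] : exists u v, e u v /\ 0 < height u v.
  apply: contrapT => hN; apply: Gamma_nonunimodular => x y.
  have flat u v : e u v -> height u v = 0.
    move=> euv; have evu : e v u by case: e_simple => esym _; rewrite esym.
    apply: le_anti; apply/andP; split; rewrite leNgt; apply/negP => h; apply: hN.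
      by exists u, v.
    by exists v, u; split=> //; rewrite heightC oppr_gt0.
  have [p pp <-] := e_connected x y.
  have H0 : height x (last x p) = 0.
    apply/eqP; rewrite -normr_le0 -(mul0r (size p)%:R).
    by apply: path_height_bounded => // u' v' /flat ->; rewrite normr0.
  by rewrite modular_height H0 expR0.
exists (height u v) => // x; split.
  have [g Gg <-] := Gamma_transitive u x; exists (g v).
    by rewrite Gamma_edge.
  exact: height_translate.
have [g Gg <-] := Gamma_transitive v x; exists (g u).
  by rewrite Gamma_edge//; case: e_simple => -> _.
by rewrite height_translate// heightC.
Qed.

(** A walk that climbs at each step cannot return. *)
Lemma climbing_saw eta x n : 0 < eta ->
  (forall x, exists2 y, e x y & height x y = eta) ->
  exists p, [/\ saw e x n p, height x (last x p) = eta *+ n &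
    forall y, y \in p -> 0 < height x y].
Proof.
move=> eta0 climb; elim: n x => [|n IH] x.
  by exists [::]; split=> //=; rewrite height_refl.
have [y exy hy] := climb x; have [p [[sp pp up] hp pos]] := IH y.
have pos' u : u \in y :: p -> 0 < height x u.
  rewrite inE => /predU1P[->|/pos]; first by rewrite hy.
  by rewrite -(heightD x y) hy; lra.
exists (y :: p); split=> //=; last by rewrite -(heightD x y) hy hp mulrS.
split=> //=; rewrite ?sp ?exy ?pp//.
move: up => /= ->; rewrite andbT; apply/negP => /pos'.
by rewrite height_refl ltxx.
Qed.

Lemma saw_Z_lower o k : exists2 c, 0 < c & forall n, c ^+ n <= Z o k n.
Proof.
have [eta eta0 climb] := climbing_edge.
exists (expR (k * eta)) => [|n]; first exact: expR_gt0.
have [p [pS hp _]] := climbing_saw o n eta0 (fun x => (climb x).1).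
rewrite -lee_fin saw_Z_walk_sum.
have -> : expR (k * eta) ^+ n = walk_weight 1 k o p.
  by rewrite /walk_weight hp expr1n mul1r -expRM_natl mulr_natl mulrnAr.
apply: (@esum_term _ _ (saw e o n) (fun q => (walk_weight 1 k o q)%:E)) => //.
by rewrite lee_fin walk_weight_ge0.
Qed.

Lemma saw_Z_gt0 o k n : 0 < Z o k n.
Proof.
by have [c c0 cZ] := saw_Z_lower o k; apply: lt_le_trans (cZ n); exact: exprn_gt0.
Qed.

Local Notation mu o k := (@mu_c V R e Gamma o k).

Lemma mu_c_inf o k :
  mu o k = inf [set Z o k n `^ n%:R^-1 | n in [set n | (0 < n)%N]] /\ 0 < mu o k.
Proof.
have [c c0 cZ] := saw_Z_lower o k.
have i0 : 0 < inf [set Z o k n `^ n%:R^-1 | n in [set n | (0 < n)%N]].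
  apply: (lt_le_trans c0); apply: lb_le_inf.
    by exists (Z o k 1 `^ 1%:R^-1); exists 1%N.
  move=> _ [n /= n0 <-].
  by rewrite le_rootE ?cZ ?(ltW c0) ?(ltW (saw_Z_gt0 _ _ _)).
have E : mu o k = inf [set Z o k n `^ n%:R^-1 | n in [set n | (0 < n)%N]].
  apply/cvg_lim => //.
  exact: submul_cvg (saw_Z_gt0 o k) (saw_Z_submul o k) i0.
by rewrite E.
Qed.

Lemma mu_c_gt0 o k : 0 < mu o k.
Proof. exact: (mu_c_inf o k).2. Qed.

Lemma mu_c_le_saw_Z o k n : mu o k ^+ n <= Z o k n.
Proof.
rewrite (mu_c_inf o k).1.
exact: submul_inf_le (saw_Z_gt0 o k) (saw_Z_submul o k) n.
Qed.

Lemma saw_Z_exp_bound o k nu : mu o k < nu ->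
  exists2 K, 0 < K & forall n, Z o k n <= K * nu ^+ n.
Proof.
rewrite (mu_c_inf o k).1.
exact: submul_exp_bound (saw_Z_gt0 o k) (saw_Z_submul o k) nu.
Qed.

(** Stated with an exponential factor [d ^+ n] so as to serve both for
    monotonicity ([d = 1]) and for the Lipschitz bound. *)
Lemma mu_c_le o k k' C d : 0 < C -> 0 < d ->
  (forall n, Z o k' n <= C * d ^+ n * Z o k n) -> mu o k' <= d * mu o k.
Proof.
move=> C0 d0 CZ; rewrite -ler_pdivrMl//; apply/ler_addgt0Pr => eps eps0.
set nu := _ + eps; have munu : mu o k < nu by rewrite ltrDl.
have [K K0 KZ] := saw_Z_exp_bound munu.
have nu0 := lt_trans (mu_c_gt0 o k) munu.
rewrite ler_pdivrMl//.
apply: (@exp_growth_le _ _ _ (C * K)); rewrite ?mu_c_gt0 ?mulr_gt0// => n.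
apply: le_trans (mu_c_le_saw_Z o k' n) _; apply: le_trans (CZ n) _.
rewrite exprMn mulrACA; apply: ler_pM => //; rewrite ?mulr_ge0 ?exprn_ge0// ltW//.
exact: saw_Z_gt0.
Qed.

Lemma mu_c_symmetric o k : mu o (1 - k) = mu o k.
Proof.
have E : saw_Z e Gamma o (1 - k) = saw_Z e Gamma o k.
  by apply/funext => n; exact: saw_Z_symmetric.
by rewrite /mu_c E.
Qed.

(** Between [a] and [1 - a] the tilt is dominated termwise by the two extreme
    tilts, which have the same partition function. *)
Lemma mu_c_monotone o a k : a <= k -> k <= 1 - a -> mu o k <= mu o a.
Proof.
move=> ak ka; rewrite -[leRHS]mul1r; apply: (@mu_c_le o a k 2 1) => // n.
rewrite expr1n mulr1 mulrDl mul1r -{1}(saw_Z_symmetric o a).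
rewrite -lee_fin EFinD !saw_Z_walk_sum /walk_sum -esumD; last 2 first.
- by move=> p _; rewrite lee_fin walk_weight_ge0.
- by move=> p _; rewrite lee_fin walk_weight_ge0.
apply: le_esum => p _; rewrite lee_fin /walk_weight expr1n !mul1r.
set h := height _ _; have [h0|h0] := leP 0 h.
  apply: (@le_trans _ _ (expR ((1 - a) * h))); last by rewrite lerDl expR_ge0.
  by rewrite ler_expR ler_wpM2r.
apply: (@le_trans _ _ (expR (a * h))); last by rewrite lerDr expR_ge0.
by rewrite ler_expR ler_wnM2r// ltW.
Qed.

(** Walks of length [n] have height at most [M n], so changing the tilt by
    [d] changes the partition function by at most a factor [expR (d M n)]. *)
Lemma ln_mu_c_lipschitz o : exists M, forall k k',
  `|ln (mu o k) - ln (mu o k')| <= M * `|k - k'|.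
Proof.
have [M M0 MP] := edge_height_bounded; exists M.
have half k k' : ln (mu o k) - ln (mu o k') <= M * `|k - k'|.
  suff : mu o k <= expR (M * `|k - k'|) * mu o k'.
    move: (mu_c_gt0 o k) (mu_c_gt0 o k').
    move: (mu o k) (mu o k') => u v u0 v0 uv.
    by rewrite lerBlDr -ler_expR expRD !lnK.
  apply: (@mu_c_le _ _ _ 1) => [||n]; rewrite ?expR_gt0//.
  rewrite mul1r -lee_fin EFinM !saw_Z_walk_sum /walk_sum -esumZ; last 2 first.
  - by rewrite exprn_ge0// expR_ge0.
  - by move=> p; rewrite lee_fin walk_weight_ge0.
  apply: le_esum => p [sp pp _].
  rewrite -EFinM lee_fin /walk_weight expr1n !mul1r -expRM_natl -expRD ler_expR.
  have := path_height_bounded MP pp; rewrite sp => hp.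
  rewrite -lerBlDr -mulrBl; apply: le_trans (ler_norm _) _.
  by rewrite normrM mulrA [leRHS]mulrC ler_wpM2l// [leRHS]mulrC.
move=> k k'; rewrite ler_norml half andbT lerNl opprB distrC.
exact: half.
Qed.

Lemma z_c_continuous o : continuous (fun k : R => z_c e Gamma o k).
Proof.
have [M MP] := ln_mu_c_lipschitz o.
have E : (fun k : R => z_c e Gamma o k) = expR \o (fun k => - ln (mu o k)).
  by apply/funext => k; rewrite /= expRN lnK// posrE mu_c_gt0.
rewrite E => k; apply: continuous_comp; last exact: continuous_expR.
apply: cvgN; apply/cvgrPdist_le => eps eps0.
have d0 : 0 < eps / (`|M| + 1) by rewrite divr_gt0// ltr_wpDl.
near=> k'.
apply: le_trans (MP k k') _.
apply: (@le_trans _ _ ((`|M| + 1) * `|k - k'|)).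
  by apply: ler_wpM2r => //; have := ler_norm M; lra.
rewrite -ler_pdivlMl ?ltr_wpDl// mulrC.
near: k'; exact: cvgr_dist_le.
Unshelve. all: by end_near. Qed.

(** * Bridges and their decomposition into irreducible bridges *)

(** Half-space walks decompose into bridges of alternating direction, so all
    notions come in two versions; a boolean direction allows a common proof. *)
Definition dheight (b : bool) (x y : V) : R :=
  if b then height x y else - height x y.

Lemma dheightD b x y u : dheight b x y + dheight b y u = dheight b x u.
Proof. by have := heightD x y u; case: b => /=; lra. Qed.

Lemma dheight_refl b x : dheight b x x = 0.
Proof. by case: b; rewrite /= height_refl ?oppr0. Qed.

Lemma dheight_negb b x y : dheight (~~ b) x y = - dheight b x y.
Proof. by case: b => //=; rewrite opprK. Qed.

Lemma dheight_translate g b x y : Gamma g -> dheight b (g x) (g y) = dheight b x y.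
Proof. by move=> Gg; rewrite /dheight height_translate. Qed.

Definition all_saw x : set (seq V) := [set p | path e x p /\ uniq (x :: p)].

Definition halfspace b x : set (seq V) :=
  [set p | all_saw x p /\ forall y, y \in p -> 0 < dheight b x y].

(** The start is a strict minimum while the end is a weak maximum: with one of
    the two strict, concatenations of bridges are again self-avoiding, and hence
    bridges. *)
Definition bridge b x : set (seq V) :=
  [set p | [/\ halfspace b x p, p != [::] &
    forall y, y \in p -> dheight b x y <= dheight b x (last x p)]].

Definition irreducible_bridge b x : set (seq V) :=
  [set p | bridge b x p /\
    forall q r, p = q ++ r -> bridge b x q -> ~ bridge b (last x q) r].

Lemma all_saw_invariant : translation_invariant all_saw.
Proof.
move=> g x p Gg [pp up]; split; first by rewrite Gamma_path.
by rewrite -map_cons map_inj_uniq//; exact: Gamma_inj.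
Qed.

Lemma halfspace_invariant b : translation_invariant (halfspace b).
Proof.
move=> g x p Gg [pS pos]; split; first exact: all_saw_invariant.
by move=> _ /mapP[y yp ->]; rewrite dheight_translate//; exact: pos.
Qed.

Lemma bridge_invariant b : translation_invariant (bridge b).
Proof.
move=> g x p Gg [pH p0 pmax]; split; first exact: halfspace_invariant.
  by case: p p0 {pH pmax}.
by move=> _ /mapP[y yp ->]; rewrite last_map !dheight_translate//; exact: pmax.
Qed.

Lemma bridge_last_gt0 b x p : bridge b x p -> 0 < dheight b x (last x p).
Proof.
case=> [[_ pos] p0 _]; apply: pos.
by case: p p0 => //= y p _; exact: mem_last.
Qed.

Lemma all_saw_cat x q r : all_saw x (q ++ r) ->
  all_saw x q /\ all_saw (last x q) r.
Proof.
case=> pp; rewrite -cat_cons cat_uniq => /and3P[uq /hasPn qr ur].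
move: pp; rewrite cat_path => /andP[qp rp].
do 2!split=> //; rewrite cons_uniq ur andbT; apply/negP => /qr.
by rewrite mem_last.
Qed.

Lemma halfspace_prefix b x q r : halfspace b x (q ++ r) -> halfspace b x q.
Proof.
case=> /all_saw_cat[qS _] pos; split=> // y yq.
by apply: pos; rewrite mem_cat yq.
Qed.

Lemma bridge_cat b x q r :
  bridge b x q -> bridge b (last x q) r -> bridge b x (q ++ r).
Proof.
move=> qB rB; have [[[qp uq] qpos] q0 qmax] := qB.
have [[[rp ur] rpos] r0 rmax] := rB.
have q1 := bridge_last_gt0 qB; have r1 := bridge_last_gt0 rB.
have up y : y \in r -> dheight b x (last x q) < dheight b x y.
  by move=> /rpos; rewrite -(dheightD b x (last x q) y); lra.
split; last 1 first.
- move=> y; rewrite mem_cat last_cat -(dheightD b x (last x q) (last _ r)).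
  case/orP => [/qmax|/rmax]; first by lra.
  by rewrite -(dheightD b x (last x q) y); lra.
- split; last first.
    by move=> y; rewrite mem_cat => /orP[/qpos//|/up]; lra.
  split; first by rewrite cat_path qp.
  rewrite -cat_cons cat_uniq uq; move: ur => /= /andP[_ ->]; rewrite andbT.
  apply/hasPn => y /up hy; apply/negP; rewrite inE => /predU1P[E|/qmax].
    by move: hy; rewrite E dheight_refl; lra.
  by rewrite leNgt hy.
- by case: q q0 {qB qp uq qpos qmax rB rp ur rpos rmax q1 r1 up}.
Qed.

(** That [t] stays above its start follows from the second bridge, that it ends
    at its maximum from the first. *)
Lemma bridge_suffix b x q t r : bridge b x (q ++ t) -> t != [::] ->
  bridge b (last x q) (t ++ r) -> bridge b (last x q) t.
Proof.
move=> [_ _ qtmax] t0 [/halfspace_prefix tH _ _]; split=> // y yt.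
have := qtmax y; rewrite mem_cat yt orbT last_cat => /(_ isT).
rewrite -(dheightD b x (last x q) y) -(dheightD b x (last x q) (last _ t)).
by rewrite lerD2l.
Qed.

(** Otherwise the end of the shorter irreducible bridge would split the longer
    one. *)
Lemma irreducible_prefix_unique b x q r q' r' :
  irreducible_bridge b x q -> bridge b (last x q) r ->
  irreducible_bridge b x q' -> bridge b (last x q') r' ->
  q ++ r = q' ++ r' -> q = q'.
Proof.
wlog: q r q' r' / (size q <= size q')%N => [wl|le_qq'] qI rB q'I r'B E.
  have [le_qq'|/ltnW le_q'q] := leqP (size q) (size q'); first exact: (wl q r q' r').
  exact/esym/(wl q' r' q r).
have Eq : q' = q ++ drop (size q) q'.
  rewrite -{1}(cat_take_drop (size q) q'); congr (_ ++ _).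
  have := congr1 (take (size q)) E.
  by rewrite take_size_cat// takel_cat.
set t := drop (size q) q' in Eq.
have Er : r = t ++ r'.
  by move/eqP: E; rewrite Eq -catA eqseq_cat// eqxx => /eqP.
have [t0|t0] := eqVneq t [::]; first by rewrite Eq t0 cats0.
have [q'B q'irr] := q'I; have [qB _] := qI.
case: (q'irr q t Eq qB).
by apply: (@bridge_suffix b x q t r'); rewrite -?Eq// -Er.
Qed.

Lemma bridge_first_irreducible b x p : bridge b x p ->
  exists q r, [/\ p = q ++ r, irreducible_bridge b x q &
    r = [::] \/ bridge b (last x q) r].
Proof.
have [n] := ubnP (size p); elim: n p => // n IH p; rewrite ltnS => pn pB.
have [pI|pN] := pselect (irreducible_bridge b x p).
  by exists p, [::]; rewrite cats0; split=> //; left.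
have [q [r [E qB rB]]] : exists q r,
    [/\ p = q ++ r, bridge b x q & bridge b (last x q) r].
  apply: contrapT => nosplit; apply: pN; split=> // q r E qB rB; apply: nosplit.
  by exists q, r.
have r0 : (0 < size r)%N by case: rB => _; case: (r).
have [|q1 [r1 [Eq q1I r1B]]] := IH q _ qB.
  by apply: leq_trans pn; rewrite E size_cat -addn1 leq_add2l.
exists q1, (r1 ++ r); rewrite E Eq catA; split=> //; right.
case: r1B Eq => [->|r1B] Eq; first by rewrite Eq cats0 in rB.
by apply: bridge_cat => //; rewrite -last_cat -Eq.
Qed.

Section BridgeSums.
Variables (z : R).
Hypothesis z0 : 0 < z.
Local Notation S := (walk_sum z).

Let zge0 : 0 <= z. Proof. exact: ltW. Qed.

Lemma walk_sum_fin_num k x A c : (S k x A <= c%:E)%E -> S k x A \is a fin_num.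
Proof.
move=> Ac; rewrite ge0_fin_numE ?walk_sum_ge0//.
exact: le_lt_trans Ac (ltry c).
Qed.

(** An irreducible bridge followed by a bridge is a bridge that determines its
    first piece, so [I * B <= B] with [0 < B]. *)
Lemma irreducible_sum_le1 k b x :
  (exists y, bridge b x [:: y]) ->
  S k x (bridge b x) \is a fin_num ->
  (S k x (irreducible_bridge b x) <= 1)%E.
Proof.
move=> [y yB] Bfin; set B := fine (S k x (bridge b x)).
have BE : S k x (bridge b x) = B%:E by rewrite fineK.
have w0 : 0 < walk_weight z k x [:: y] by rewrite mulr_gt0 ?expr1 ?expR_gt0.
have B0 : 0 < B.
  apply: (lt_le_trans w0); rewrite -lee_fin -BE.
  apply: (@esum_term _ _ (bridge b x) (fun p => (walk_weight z k x p)%:E)) => //.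
  by rewrite lee_fin ltW.
have : (B%:E * S k x (irreducible_bridge b x) <= B%:E)%E.
  rewrite -{2}BE; apply: (walk_sum_ge_catM zge0 (bridge_invariant (b := b))).
  - by move=> q r [qB _]; exact: bridge_cat.
  - exact: irreducible_prefix_unique.
  - exact: ltW.
  - by rewrite BE.
by rewrite -{2}(mule1 B%:E) lee_pmul2l.
Qed.

(** Removing the first irreducible bridge gives [B <= I * (1 + B)]. *)
Lemma bridge_sum_renewal k b x beta :
  0 < beta -> (S k x (irreducible_bridge b x) <= (1 - beta)%:E)%E ->
  S k x (bridge b x) \is a fin_num ->
  (S k x (bridge b x) <= (beta^-1)%:E)%E.
Proof.
move=> beta0 Ile Bfin; set B := fine (S k x (bridge b x)).
have BE : S k x (bridge b x) = B%:E by rewrite fineK.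
have B0 : 0 <= B by rewrite -lee_fin -BE walk_sum_ge0.
pose C x := [set [::]] `|` bridge b x.
have Cinv : translation_invariant C.
  move=> g u p Gg [->|pB]; first by left.
  by right; exact: bridge_invariant.
have : (S k x (bridge b x) <= (1 + B)%:E * S k x (irreducible_bridge b x))%E.
  apply: (walk_sum_le_catM zge0 Cinv).
  - move=> p /bridge_first_irreducible[q [r [-> qI rB]]].
    by exists q, r.
  - by rewrite addr_ge0.
  - apply: le_trans (walk_sumU _ _ _ _ _) _ => //.
    by rewrite walk_sum_nil// BE.
rewrite BE => le1.
have : (B%:E <= ((1 + B) * (1 - beta))%:E)%E.
  by apply: (le_trans le1); rewrite EFinM lee_wpmul2l// lee_fin addr_ge0.
rewrite !lee_fin => le2; rewrite -[leRHS]mul1r ler_pdivlMr//.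
by have := mulr_ge0 B0 (ltW beta0); lra.
Qed.

(** The single step to [y] is an irreducible bridge, whose weight alone makes
    the sums with tilts [k] and [k'] differ by [gap]; the one with tilt [k'] is
    at most 1. *)
Lemma irreducible_sum_gap k k' b x y gap :
  (forall p, bridge b x p -> walk_weight z k x p <= walk_weight z k' x p) ->
  bridge b x [:: y] ->
  walk_weight z k x [:: y] + gap <= walk_weight z k' x [:: y] ->
  S k' x (bridge b x) \is a fin_num ->
  (S k x (irreducible_bridge b x) <= (1 - gap)%:E)%E.
Proof.
move=> kk' yB ygap B'fin.
have I'1 : (S k' x (irreducible_bridge b x) <= 1)%E.
  by apply: irreducible_sum_le1 => //; exists y.
have yI : irreducible_bridge b x [:: y].
  split=> // -[|u q] [|u' r] //=; first by move=> _ [].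
    by move=> _ _ [].
  by case: q.
rewrite EFinB leeBrDr//.
apply: le_trans I'1.
pose d p := walk_weight z k' x p - walk_weight z k x p.
have d0 p : bridge b x p -> 0 <= d p.
  by move=> pB; rewrite subr_ge0; exact: kk'.
apply: (@le_trans _ _ (S k x (irreducible_bridge b x) +
   \esum_(p in irreducible_bridge b x) (d p)%:E)%E).
  apply: leeD2l; apply: (@le_trans _ _ (d [:: y])%:E).
    by rewrite lee_fin lerBrDl.
  apply: (@esum_term _ _ (irreducible_bridge b x) (fun p => (d p)%:E)) => //.
  by rewrite lee_fin; exact: d0.
rewrite /walk_sum -esumD; last 2 first.
- by move=> p _; rewrite lee_fin walk_weight_ge0.
- by move=> p [pB _]; rewrite lee_fin; exact: d0.
by apply: le_esum => p _; rewrite -EFinD lee_fin /d addrC subrK.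
Qed.

End BridgeSums.

(** * Half-space walks *)

Section HalfspaceSums.
Variables (z k beta : R) (x0 : V).
Hypotheses (z0 : 0 < z)
  (bridge_bound : forall b x, (walk_sum z k x (bridge b x) <= beta%:E)%E).
Local Notation S := (walk_sum z k).

Let zge0 : 0 <= z. Proof. exact: ltW. Qed.

Definition short_bridge t b x : set (seq V) :=
  [set p | bridge b x p /\ dheight b x (last x p) < t].

Definition low_halfspace n t b x : set (seq V) :=
  [set p | [/\ halfspace b x p, (size p <= n)%N &
    forall y, y \in p -> dheight b x y < t]].

Lemma short_bridge_invariant t b : translation_invariant (short_bridge t b).
Proof.
move=> g x p Gg [pB pt]; split; first exact: bridge_invariant.
by rewrite last_map dheight_translate.
Qed.

Let short_sum t b : R := fine (S x0 (short_bridge t b x0)).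

Let potential t : R := short_sum t true + short_sum t false.

Let short_sumE t b x : S x (short_bridge t b x) = (short_sum t b)%:E.
Proof.
rewrite (walk_sum_invariant z k x x0 (short_bridge_invariant (t := t) (b := b))) fineK//.
apply: (walk_sum_fin_num z0 (c := beta)); apply: le_trans (bridge_bound b x0).
by apply: walk_sum_subset => p [].
Qed.

Let short_sum_ge0 t b : 0 <= short_sum t b.
Proof. by rewrite -lee_fin -(short_sumE t b x0) walk_sum_ge0. Qed.

Let potential_ge0 t : 0 <= potential t.
Proof. exact: addr_ge0. Qed.

Let potential_le t : potential t <= beta + beta.
Proof.
have le b : short_sum t b <= beta.
  rewrite -lee_fin -(short_sumE t b x0); apply: le_trans (bridge_bound b x0).
  by apply: walk_sum_subset => p [].
exact: lerD.
Qed.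

(** Bridges of span [s] are disjoint from those of span less than [s], and both
    have span less than [t]. *)
Let short_sum_increase b x s t X : s < t -> uniq X ->
  (forall q, q \in X -> bridge b x q /\ dheight b x (last x q) = s) ->
  potential s + \sum_(q <- X) walk_weight z k x q <= potential t.
Proof.
move=> st uX XP.
have le b' : short_sum s b' <= short_sum t b'.
  rewrite -lee_fin -!(short_sumE _ b' x0); apply: walk_sum_subset => p [pB ps].
  by split=> //; exact: lt_trans st.
suff : short_sum s b + \sum_(q <- X) walk_weight z k x q <= short_sum t b.
  by have := le (~~ b); rewrite /potential; case: (b) => /=; lra.
rewrite -lee_fin EFinD -!(short_sumE _ b x).
have XE : (\sum_(q <- X) walk_weight z k x q)%:E = S x [set` X].
  have finX : finite_set [set` X] by exact: finite_seq.
  rewrite /walk_sum esum_fset//.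
    by rewrite -sumEFin fsbig_seq.
  by move=> *; rewrite lee_fin walk_weight_ge0.
rewrite XE /walk_sum [leRHS](esumID [set` X]); last first.
  by move=> *; rewrite lee_fin walk_weight_ge0.
rewrite addeC; apply: leeD; apply: esum_subset => p.
  move=> /= pX; split=> //; have [pB ps] := XP p pX.
  by split=> //; rewrite ps.
move=> [pB ps]; split; first by split=> //; exact: lt_trans st.
by move=> /= /XP[_ E]; move: ps; rewrite E ltxx.
Qed.

Let short_bridge_potential t b x :
  (\esum_(q in short_bridge t b x)
     (walk_weight z k x q * expR (potential (dheight b x (last x q))))%:E
   <= (expR (potential t) - 1)%:E)%E.
Proof.
apply: esum_le_bound => X finX XS.
rewrite fsbig_finite//= sumEFin lee_fin.
apply: (@sum_exp_potential R _ (bridge b x) (fun q => dheight b x (last x q))).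
- by move=> q; exact: walk_weight_ge0.
- exact: potential_ge0.
- by move=> s t' Y; exact: short_sum_increase.
- exact: fset_uniq.
- by move=> q; rewrite in_fset_set// inE => /XS[].
Qed.

(** The cut is at the last highest vertex, so that all later vertices are
    strictly lower; being strictly higher than the start, they span less than
    the first piece. *)
Let halfspace_split n t b x p : low_halfspace n.+1 t b x p -> p != [::] ->
  exists q r, [/\ p = q ++ r, short_bridge t b x q &
    low_halfspace n (dheight b x (last x q)) (~~ b) (last x q) r].
Proof.
case: p => // y p [[pS pos] psz plt] _.
have [q [r [E /allP qmax /allP rmax]]] := split_last_max (dheight b x) y p.
have pE : y :: p = (y :: q) ++ r by rewrite E.
rewrite pE in pS pos psz plt *.
have [qS rS] := all_saw_cat pS.
exists (y :: q), r; split=> //=.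
  split; last by apply: plt; rewrite mem_cat /= mem_last.
  split=> //; split=> // u uq; apply: pos; rewrite mem_cat.
  by rewrite uq.
have hr u : u \in r -> dheight (~~ b) (last y q) u =
    dheight b x (last y q) - dheight b x u.
  by move=> _; rewrite dheight_negb -(dheightD b x (last y q) u); lra.
split.
- by split=> // u ur; rewrite hr// subr_gt0; exact: rmax.
- by move: psz; rewrite /= ltnS size_cat; apply: leq_trans; rewrite leq_addl.
- move=> u ur; rewrite hr//.
  have : 0 < dheight b x u by apply: pos; rewrite mem_cat ur orbT.
  by lra.
Qed.

(** By induction on the length: after the first bridge, of span [s], the
    remaining walks contribute at most [expR (potential s)], and
    [short_bridge_potential] sums this over the first bridge. *)
Let low_halfspace_sum n t b x :
  (S x (low_halfspace n t b x) <= (expR (potential t))%:E)%E.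
Proof.
have e1 t' : (1 <= (expR (potential t'))%:E :> \bar R)%E.
  rewrite lee_fin; have := expR_ge1Dx (potential t').
  by have := potential_ge0 t'; lra.
elim: n t b x => [|n IH] t b x.
  apply: le_trans (e1 t); rewrite -(walk_sum_nil z k x).
  by apply: walk_sum_subset => p [_ /=]; rewrite leqn0 size_eq0 => /eqP -> _.
pose G := low_halfspace n.+1 t b x `&` [set p | p != [::]].
apply: (@le_trans _ _ (S x [set [::]] + S x G)%E).
  apply: le_trans (walk_sumU k zge0 _ _ _); apply: walk_sum_subset => p pH.
  by have [->|p0] := eqVneq p [::]; [left|right].
rewrite walk_sum_nil// -leeBrDl//.
apply: le_trans (short_bridge_potential t b x).
apply: (@le_trans _ _ (\esum_(q in short_bridge t b x) ((walk_weight z k x q)%:E *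
   S (last x q) (low_halfspace n (dheight b x (last x q)) (~~ b) (last x q))))%E).
  apply: (walk_sum_le_cat k zge0) => p [pH p0]; exact: halfspace_split.
apply: le_esum => q _; rewrite [leRHS]EFinM; apply: lee_wpmul2l; last exact: IH.
by rewrite lee_fin walk_weight_ge0.
Qed.

(** A finite family of half-space walks has bounded lengths and heights, so the
    bounds for the truncated sums pass to the limit. *)
Lemma halfspace_sum_bound b x : (S x (halfspace b x) <= (expR (beta + beta))%:E)%E.
Proof.
apply: esum_le_bound => X finX XH.
pose n := \max_(p <- fset_set X) size p.
pose t := 1 + \sum_(p <- fset_set X) \sum_(y <- p) `|dheight b x y|.
apply: (@le_trans _ _ (S x (low_halfspace n t b x))); last first.
  apply: le_trans (low_halfspace_sum n t b x) _.
  by rewrite lee_fin ler_expR.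
apply: esum_ge; exists X => //; split=> // p pX.
have pX' : p \in fset_set X by rewrite in_fset_set// inE.
split; first exact: XH.
  by rewrite /n (big_rem p)//= leq_maxl.
move=> y yp; rewrite /t (big_rem p)//= (big_rem y yp)/=.
set A := \sum_(_ <- _) _; set B := \sum_(_ <- _) _.
have A0 : 0 <= A by apply: sumr_ge0.
have B0 : 0 <= B by apply: sumr_ge0 => q _; apply: sumr_ge0.
by have := ler_norm (dheight b x y); lra.
Qed.

End HalfspaceSums.

(** * Divergence at the critical point and strict monotonicity *)

Lemma all_saw_sumE z k o : 0 <= z ->
  walk_sum z k o (all_saw o) = (\sum_(n <oo) (z ^+ n * Z o k n)%:E)%E.
Proof.
move=> z0; rewrite nneseries_esumT; last first.
  by move=> n; rewrite lee_fin mulr_ge0 ?exprn_ge0// ltW// saw_Z_gt0.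
have -> : all_saw o = \bigcup_(n in [set: nat]) saw e o n.
  apply/seteqP; split=> [p [pp up]|p [n _ [_ pp up]]]; last by [].
  by exists (size p).
rewrite /walk_sum esum_bigcupT.
- by apply: eq_esum => n _; rewrite -walk_sum_saw.
- by move=> n m _ _ [p [[<- _ _] [<- _ _]]].
- by move=> p; rewrite lee_fin walk_weight_ge0.
Qed.

Lemma all_saw_sum_fin_num z k o : 0 < z -> z * mu o k < 1 ->
  walk_sum z k o (all_saw o) \is a fin_num.
Proof.
move=> z0 zmu; pose nu := (mu o k + z^-1) / 2.
have muz : mu o k < z^-1 by rewrite -[ltRHS]mul1r ltr_pdivlMr// mulrC.
have munu : mu o k < nu by rewrite /nu; lra.
have nu0 := lt_trans (mu_c_gt0 o k) munu.
have [K K0 KZ] := saw_Z_exp_bound munu.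
have znu : z * nu < 1.
  by rewrite mulrC -ltr_pdivlMr// mul1r /nu; lra.
apply: (walk_sum_fin_num z0 (c := K * (1 - z * nu)^-1)).
rewrite all_saw_sumE ?(ltW z0)//; apply: lime_le.
  apply: is_cvg_nneseries => n _ _.
  by rewrite lee_fin mulr_ge0 ?exprn_ge0 ?ltW// saw_Z_gt0.
apply: nearW => n; rewrite sumEFin lee_fin.
have znu0 : 0 < z * nu by rewrite mulr_gt0.
apply: le_trans (geometric_le_lim n (ltW K0) znu0 _); last by rewrite gtr0_norm.
rewrite /series/=; apply: ler_sum => i _.
by rewrite exprMn mulrCA ler_wpM2l ?exprn_ge0// ltW.
Qed.

(** Each of the first [n] lengths contributes at least
    [(z * mu) ^+ i >= (z * mu) ^+ n]. *)
Lemma all_saw_sum_lower z k o n : 0 < z -> z * mu o k <= 1 ->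
  ((n%:R * (z * mu o k) ^+ n)%:E <= walk_sum z k o (all_saw o))%E.
Proof.
move=> z0 zmu; rewrite all_saw_sumE ?(ltW z0)//.
have t0 i : 0 <= z ^+ i * Z o k i by rewrite mulr_ge0 ?exprn_ge0 ?ltW// saw_Z_gt0.
apply: le_trans (nneseries_lim_ge n _); last by move=> i _ _; rewrite lee_fin.
rewrite sumEFin lee_fin big_mkord mulr_natl -[X in _ *+ X]card_ord -sumr_const.
apply: ler_sum => i _; apply: (@le_trans _ _ ((z * mu o k) ^+ i)).
  have zmu0 : 0 <= z * mu o k by rewrite mulr_ge0 ?ltW// mu_c_gt0.
  by apply: ler_wiXn2l => //; exact: ltnW.
rewrite exprMn; apply: ler_wpM2l; first by rewrite exprn_ge0// ltW.
exact: mu_c_le_saw_Z.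
Qed.

(** Tilting towards [1 - a] favours upward bridges and tilting towards [a]
    favours downward ones, and at these extreme tilts the irreducible bridges
    have total weight at most 1. The constant [delta] does not depend on [z], so
    the bound persists up to the critical point. *)
Lemma bridge_sum_bound o a k : a < k -> k < 1 - a ->
  exists2 delta, 0 < delta & forall z b x, 0 < z -> z * mu o a < 1 ->
    (walk_sum z k x (bridge b x) <= ((z * delta)^-1)%:E)%E.
Proof.
move=> ak ka; have [eta eta0 climb] := climbing_edge.
pose top (b : bool) := if b then 1 - a else a.
pose s (b : bool) := if b then eta else - eta.
pose d b := expR (top b * s b) - expR (k * s b).
have kmu : mu o k <= mu o a by apply: mu_c_monotone; exact: ltW.
have d0 b : 0 < d b.
  by rewrite subr_gt0 ltr_expR; case: b => /=; rewrite ?mulrN ?ltrN2 ltr_pM2r.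
exists (Num.min (d true) (d false)); first by rewrite lt_min !d0.
move=> z b x z0 zmu; set delta := Num.min _ _.
have delta0 : 0 < delta by rewrite lt_min !d0.
have le_d : delta <= d b by case: (b); rewrite ge_min lexx ?orbT.
have fin k' : z * mu o k' < 1 -> walk_sum z k' x (bridge b x) \is a fin_num.
  move=> h; have F := all_saw_sum_fin_num z0 h.
  apply: (walk_sum_fin_num z0 (c := fine (walk_sum z k' o (all_saw o)))).
  rewrite (fineK F); have -> := walk_sum_invariant z k' o x all_saw_invariant.
  by apply: walk_sum_subset => p [[]].
have [y exy hy] : exists2 y, e x y & height x y = s b.
  by case: (b) => /=; have [] := climb x.
have dy : dheight b x y = eta by rewrite /dheight hy; case: (b); rewrite //= opprK.
apply: (bridge_sum_renewal z0); first exact: mulr_gt0.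
  apply: (@irreducible_sum_gap z z0 k (top b) b x y).
  - move=> p pB; rewrite /walk_weight ler_wpM2l ?exprn_ge0 ?(ltW z0)// ler_expR.
    have := bridge_last_gt0 pB; rewrite /dheight /top.
    case: (b) => h; first by rewrite ler_wpM2r ?ltW.
    by move: h; rewrite oppr_gt0 => h; rewrite ler_wnM2r ?ltW.
  - split=> //; last by move=> u; rewrite inE => /eqP ->.
    split; last by move=> u; rewrite inE => /eqP ->; rewrite dy.
    split; rewrite /= ?exy// inE andbT; apply/eqP => xy.
    by move: dy; rewrite -xy dheight_refl => E; move: eta0; rewrite -E ltxx.
  - rewrite /walk_weight /= expr1 hy -mulrDr ler_wpM2l ?(ltW z0)//.
    by rewrite addrC -lerBrDr.
  - by apply: fin; rewrite /top; case: (b); rewrite ?mu_c_symmetric.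
apply: fin; apply: le_lt_trans zmu; apply: ler_wpM2l => //; exact: ltW.
Qed.

Definition weak_halfspace x : set (seq V) :=
  [set p | all_saw x p /\ forall y, y \in p -> 0 <= height x y].

(** Preceding a weak half-space walk by a step up makes it strict. *)
Lemma weak_halfspace_sum_bound z k v x eta c : 0 < z ->
  e v x -> height v x = eta -> 0 < eta ->
  (walk_sum z k v (halfspace true v) <= c%:E)%E ->
  (walk_sum z k x (weak_halfspace x) <= (c / (z * expR (k * eta)))%:E)%E.
Proof.
move=> z0 evx hvx eta0 Hc; have zge0 := ltW z0.
have u0 : 0 < z * expR (k * eta) by rewrite mulr_gt0// expR_gt0.
rewrite mulrC EFinM lee_pdivlMl//.
apply: le_trans Hc.
rewrite /walk_sum -esumZ; last 2 first.
- exact: ltW.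
- by move=> *; rewrite lee_fin walk_weight_ge0.
rewrite (@eq_esum _ _ _ _ (fun p => (walk_weight z k v (x :: p))%:E)); last first.
  by move=> p _; rewrite -EFinM -cat1s walk_weight_cat /walk_weight/= expr1 hvx.
apply: (@esum_ge_inj R _ _ (halfspace true v) _ (cons x)
  (fun p => (walk_weight z k v p)%:E)); first by move=> p q _ _ [].
move=> _ [p [[pp up] pos] <-].
have pos' u : u \in x :: p -> 0 < height v u.
  rewrite inE => /predU1P[->|/pos]; first by rewrite hvx.
  by rewrite -(heightD v x u) hvx; lra.
split=> //; split; first by rewrite /= evx.
rewrite cons_uniq up andbT; apply/negP => /pos'.
by rewrite height_refl ltxx.
Qed.

(** Cutting a walk at its last lowest vertex leaves two half-space walks, the
    first of which is traversed backwards and so carries the tilt [1 - k]. *)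
Lemma all_saw_sum_bound z k x eta c c' : 0 < z -> 0 <= c ->
  0 < eta -> (exists2 v, e v x & height v x = eta) ->
  (forall y, walk_sum z k y (halfspace true y) <= c%:E)%E ->
  (forall y, walk_sum z (1 - k) y (halfspace true y) <= c'%:E)%E ->
  (walk_sum z k x (all_saw x) <=
    (c * (c' / (z * expR ((1 - k) * eta))))%:E)%E.
Proof.
move=> z0 c0 eta0 [v evx hvx] Hc Hc'; have zge0 := ltW z0.
pose Q x := [set p | all_saw x p /\
  forall y, y \in x :: p -> 0 <= height (last x p) y].
have Qinv : translation_invariant Q.
  move=> g u p Gg [pS pos]; split; first exact: all_saw_invariant.
  move=> y; rewrite -map_cons last_map => /mapP[w wp ->].
  by rewrite height_translate//; exact: pos.
have QW : (walk_sum z k x (Q x) <= walk_sum z (1 - k) x (weak_halfspace x))%E.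
  rewrite (walk_sum_reverse _ _ zge0 Qinv); apply: walk_sum_subset => p /= [[pp up] pos].
  rewrite (rev_walkK x p).1 in pos.
  split.
    split; first last.
      by rewrite -(rev_uniq (x :: p)) -rev_walk.
    have := pp; rewrite rev_path; case: e_simple => esym _.
    by rewrite (eq_path (e' := e))// => ? ?; exact: esym.
  by move=> y yp; apply: pos; rewrite rev_walk mem_rev inE yp orbT.
have WB := weak_halfspace_sum_bound z0 evx hvx eta0 (Hc' v).
apply: (@le_trans _ _ (c%:E * walk_sum z k x (Q x))%E).
  apply: (walk_sum_le_catM zge0 (halfspace_invariant (b := true))) => //.
  move=> p pS; have [q [r [E /allP qmin /allP rmin]]] :=
    split_last_max (fun y => - height x y) x p.
  rewrite E in pS; have [qS rS] := all_saw_cat pS.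
  exists q, r; split=> //; split=> // y yP.
    by have := qmin y yP; rewrite -(heightD x (last x q) y); lra.
  by have := rmin y yP; rewrite /= -(heightD x (last x q) y); lra.
rewrite EFinM; apply: lee_wpmul2l; first by rewrite lee_fin.
exact: le_trans QW WB.
Qed.

Lemma mu_c_strict o a k : a < k -> k <= 2^-1 -> mu o k < mu o a.
Proof.
move=> ak k2; have half1 : (2^-1 : R) < 1 by lra.
have k1a : k < 1 - a by lra.
have a1k : a < 1 - k by lra.
have k1a' : 1 - k < 1 - a by lra.
rewrite ltNge; apply/negP => le_mu.
have m0 : 0 < mu o k := mu_c_gt0 o k.
have [d1 d10 B1] := bridge_sum_bound o ak k1a.
have [d2 d20 B2] := bridge_sum_bound o a1k k1a'.
have [eta eta0 climb] := climbing_edge.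
(* Half of the critical value: the bounds below are uniform in [z >= z1]. *)
pose z1 := (2 * mu o k)^-1.
have z10 : 0 < z1 by rewrite invr_gt0 mulr_gt0.
pose beta := (z1 * d1)^-1 + (z1 * d2)^-1.
pose c := expR (beta + beta).
pose C := c * (c / (z1 * expR ((1 - k) * eta))).
have C0 : 0 <= C by rewrite !(mulr_ge0, invr_ge0, expR_ge0)// ltW.
have chi_bound z : z1 <= z -> z * mu o a < 1 ->
    (walk_sum z k o (all_saw o) <= C%:E)%E.
  move=> z1z zmu; have z0 := lt_le_trans z10 z1z.
  have inv_le d : 0 < d -> (z * d)^-1 <= (z1 * d)^-1.
    by move=> d0; rewrite lef_pV2 ?posrE ?mulr_gt0// ler_pM2r.
  have inv0 d : 0 < d -> 0 <= (z1 * d)^-1.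
    by move=> d0; rewrite invr_ge0 mulr_ge0// ltW.
  have H1 x : (walk_sum z k x (halfspace true x) <= c%:E)%E.
    apply: (halfspace_sum_bound (beta := beta) o z0) => b y.
    apply: le_trans (B1 z b y z0 zmu) _; rewrite lee_fin.
    by apply: le_trans (inv_le _ d10) _; rewrite lerDl inv0.
  have H2 x : (walk_sum z (1 - k) x (halfspace true x) <= c%:E)%E.
    apply: (halfspace_sum_bound (beta := beta) o z0) => b y.
    apply: le_trans (B2 z b y z0 zmu) _; rewrite lee_fin.
    by apply: le_trans (inv_le _ d20) _; rewrite lerDr inv0.
  have [v eov hv] := (climb o).2.
  have evo : exists2 v, e v o & height v o = eta.
    exists v; first by case: e_simple => esym _; rewrite esym.
    by rewrite heightC hv opprK.
  apply: le_trans (all_saw_sum_bound z0 (expR_ge0 _) eta0 evo H1 H2) _.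
  rewrite lee_fin /C; apply: ler_wpM2l; first exact: expR_ge0.
  apply: ler_wpM2l; first exact: expR_ge0.
  by rewrite lef_pV2 ?posrE ?mulr_gt0 ?expR_gt0// ler_pM2r ?expR_gt0.
have := archi_boundP (mulr_ge0 (ler0n R 2) C0); set n := Num.bound _ => nP.
have n0 : (0 < n)%N.
  by rewrite -(ltr_nat R); apply: le_lt_trans nP; rewrite mulr_ge0.
(* [r] is the [n]-th root of 1/2, so that [z * mu = r] makes the lower bound
   [n * r ^+ n] exceed [C]. *)
pose r : R := 2^-1 `^ n%:R^-1.
have h0 : (0 : R) <= 2^-1 by rewrite invr_ge0.
have rn : r ^+ n = 2^-1.
  rewrite -powR_mulrn ?powR_ge0// -powRrM mulVf ?powRr1//.
  by rewrite pnatr_eq0 -lt0n.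
have r2 : 2^-1 <= r.
  rewrite le_rootE//; apply: (@le_trans _ _ (2^-1 ^+ 1)); last by rewrite expr1.
  by apply: ler_wiXn2l => //; exact: ltW.
have r1 : r < 1 by rewrite root_ltE// expr1n.
have rz : r / mu o k * mu o k = r by rewrite divfK// gt_eqF.
have zz1 : z1 <= r / mu o k.
  by rewrite /z1 invfM ler_pM2r ?invr_gt0.
have zmu : r / mu o k * mu o a < 1.
  apply: le_lt_trans r1; rewrite -[leRHS]rz.
  by apply: ler_wpM2l => //; exact: le_trans (ltW z10) zz1.
have := chi_bound _ zz1 zmu; apply/negP; rewrite -ltNge.
have z0 : 0 < r / mu o k := lt_le_trans z10 zz1.
apply: lt_le_trans (all_saw_sum_lower n z0 _); last by rewrite rz ltW.
by rewrite rz rn lte_fin ltr_pdivlMr// mulrC.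
Qed.

Lemma z_c_bounds o (k : R) :
  0 < z_c e Gamma o k /\ z_c e Gamma o k <= z_t R e Gamma o.
Proof.
split; first by rewrite invr_gt0 mu_c_gt0.
have inv_le u v : 0 < u -> u <= v -> v^-1 <= u^-1 :> R.
  by move=> u0 uv; rewrite lef_pV2 ?posrE// (lt_le_trans u0 uv).
apply: inv_le; first exact: mu_c_gt0.
have [k2|k2] := leP k 2^-1; first by apply: mu_c_monotone; lra.
by rewrite -(mu_c_symmetric o k); apply: mu_c_monotone; lra.
Qed.

Lemma z_c_increasing o (a k : R) : a < k -> k <= 2^-1 ->
  z_c e Gamma o a < z_c e Gamma o k.
Proof.
have inv_lt u v : 0 < u -> u < v -> v^-1 < u^-1 :> R.
  by move=> u0 uv; rewrite ltf_pV2 ?posrE// (lt_trans u0 uv).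
by move=> ak k2; apply: inv_lt (mu_c_strict o ak k2); exact: mu_c_gt0.
Qed.

End Nonunimodular.

End SelfAvoidingWalks.

Theorem theorem1p5 (R : realType) (V : choiceType) (e : rel V)
    (Gamma : set (V -> V)) (o : V)
    (e_simple : simple_graph e)
    (e_connected : connected_graph e)
    (e_locally_finite : locally_finite_graph e)
    (Gamma_aut : aut_subgroup e Gamma)
    (Gamma_transitive : transitive_group Gamma)
    (Gamma_nonunimodular : ~ unimodular R Gamma) :
  [/\ forall lambda : R,
        0 < z_c e Gamma o lambda /\ z_c e Gamma o lambda <= z_t R e Gamma o,
      continuous (fun lambda : R => z_c e Gamma o lambda) &
      {in `]-oo, (2^-1 : R)] &,
        {homo (fun lambda : R => z_c e Gamma o lambda) : x y / x < y}}].
Proof.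
split.
- by move=> lambda; exact: z_c_bounds.
- exact: z_c_continuous.
- by move=> a k _; rewrite in_itv /= => k2 ak; exact: z_c_increasing.
Qed.
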